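(* Let $g_1,\dots,g_N\in L^2(\mathbb{R})$ and $\Lambda_1,\dots,\Lambda_N\subset\mathbb{R}^2$. If $\bigcup_{n=1}^N G(g_n,\Lambda_n)$ is uniformly minimal in $L^2(\mathbb{R})$, then \[ D^+(\{\Lambda_n\}):=\limsup_{R\to\infty}\frac{\sup_{(a,b)\in\mathbb{R}^2}\sum_{n=1}^N|\Lambda_n\cap Q_{(a,b)}(R)|}{(2R)^2}\le 1. \]
   Context: For $g\in L^2(\mathbb{R})$ and $(a,b)\in\mathbb{R}^2$ put $g_{ab}(t)=e^{2\pi i b t}g(t-a)$. The Gabor system is $G(g,\Lambda)=\{g_{\lambda\mu}\}_{(\lambda,\mu)\in\Lambda}$. $Q_{(a,b)}(R)=\{(x,y):|x-a|\le R,\ |y-b|\le R\}$. A system is uniformly minimal if there is $\delta>0$ such that each element has distance greater than $\delta$ from the closed span of the remaining elements. *)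

(* Defs.v *)
From mathcomp Require Import all_boot all_order all_algebra.
From mathcomp Require Import all_classical all_reals all_analysis.
Set Implicit Arguments. Unset Strict Implicit. Unset Printing Implicit Defensive.
Import Order.TTheory GRing.Theory Num.Theory.
Import numFieldNormedType.Exports.
Local Open Scope classical_set_scope.
Local Open Scope ring_scope.

Section Gabor.
Variable R : realType.

Definition cplx := (R * R)%type.
Definition cadd (z w : cplx) : cplx := (z.1 + w.1, z.2 + w.2).
Definition cmul (z w : cplx) : cplx := (z.1 * w.1 - z.2 * w.2, z.1 * w.2 + z.2 * w.1).
Definition cexpi (t : R) : cplx := (cos t, sin t).

Definition cfun := R -> cplx.

Definition normsq (f : cfun) : \bar R :=
  (\int[@lebesgue_measure R]_(t in [set: R]) (((f t).1 ^+ 2 + (f t).2 ^+ 2)%:E))%E.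

Definition L2 (f : cfun) : Prop :=
  measurable_fun [set: R] (fun t => (f t).1) /\
  measurable_fun [set: R] (fun t => (f t).2) /\
  (normsq f < +oo)%E.

Definition gabor (g : cfun) (ab : R * R) : cfun :=
  fun t => cmul (cexpi (2 * pi * ab.2 * t)) (g (t - ab.1)).

Definition lincomb (I : Type) (e : I -> cfun) (s : seq (cplx * I)) : cfun :=
  fun t => foldr (fun p acc => cadd (cmul p.1 (e p.2 t)) acc) (0, 0) s.

Definition csub (f h : cfun) : cfun := fun t => ((f t).1 - (h t).1, (f t).2 - (h t).2).

(* squared L^2 distance from e_i to the closed linear span of {e_j : j ∈ D, j <> i};
   the distance to the closed span equals the infimum over finite combinations *)
Definition dist_span_sq (I : eqType) (D : set I) (e : I -> cfun) (i : I) : \bar R :=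
  ereal_inf [set normsq (csub (e i) (lincomb e s)) |
             s in [set s : seq (cplx * I) | forall p, p \in s -> D p.2 /\ p.2 <> i]].

Definition uniformly_minimal (I : eqType) (D : set I) (e : I -> cfun) : Prop :=
  exists delta : R, 0 < delta /\
    forall i, D i -> ((delta ^+ 2)%:E < dist_span_sq D e i)%E.

Definition Qsq (ab : R * R) (r : R) : set (R * R) :=
  [set xy | `|xy.1 - ab.1| <= r /\ `|xy.2 - ab.2| <= r].

Definition ecard (A : set (R * R)) : \bar R := (\esum_(x in A) 1)%E.

Definition upper_density (N : nat) (Lam : 'I_N -> set (R * R)) : \bar R :=
  limf_esup (fun r : R =>
     (ereal_sup [set (\sum_(n < N) ecard (Lam n `&` Qsq ab r))%E | ab in [set: R * R]]
       * ((2 * r) ^+ 2)^-1%:E)%E)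
    (pinfty_nbhs R).

End Gabor.

(* Main.v *)
(** Consider [K] elements of the system whose time-frequency shifts lie in a square
    of radius [r]. Uniform minimality provides a biorthogonal family of norm at
    most [1 / delta]. If all [K] elements are within [kappa * delta] of a space [V]
    of dimension [D], then pairing their projections to [V] with the biorthogonal
    family gives the trace of a compression of a projection: it is at least
    [K * (1 - kappa)] and at most [D].

    Such a [V] exists with [D] about [(2 * (r + rho)) ^ 2], where [rho] is
    independent of [r] and of the square: on an interval of length
    [T = 2 * (r + rho)] cut into [Q] cells, take the step functions that sample
    the exponentials whose frequencies range over an interval of length [T] in
    steps of [1 / T]. Finite combinations of indicators of intervals being dense in
    L^2, it suffices to treat a modulated indicator. Its discrete Fourier
    coefficients are geometric sums, bounded by the inverse of a sine, so that
    those outside the window have square sum [O(1 / rho)], uniformly in [Q]. *)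
Require Import Defs.
From HB Require Import structures.
From mathcomp Require Import all_boot all_order all_algebra.
From mathcomp Require Import all_classical all_reals all_analysis.
From mathcomp Require Import measurable_realfun ring lra.
Set Implicit Arguments.
Unset Strict Implicit.
Unset Printing Implicit Defensive.
Import Order.TTheory GRing.Theory Num.Theory.
Import numFieldNormedType.Exports.
Local Open Scope classical_set_scope.
Local Open Scope ring_scope.

(** A plain dimension count would not do: the [K] elements are only close to [V], so their
    projections may well be dependent, and the trace measures this loss as the fraction [kappa]. The
    biorthogonal family is never built in L^2: the inverse of the Gram matrix holds both its
    coefficients and its inner products, which leaves an argument about finite matrices.

    Step functions on a grid make the window exponentials exactly orthonormal and turn Fourier tails
    into finite sums. The dimension of [V] does not see the mesh, so [Q] may be as large as the
    modulations require. The margin [rho] acts twice: in time it keeps the shifted supports inside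
    the interval; in frequency it keeps each element away from both ends of the window, the lower
    end mattering because discrete frequencies wrap around modulo [Q].

    L^2 is treated as a real Hilbert space. Complex spans become real ones by doubling every vector,
    in the system and in [V] alike, so that the factor 2 cancels. At the end [rho] is fixed while
    [r] grows, and the boundary layer is negligible against the area. *)

Section BilinearForm.
Variables (F : realFieldType) (m n : nat) (B : 'M[F]_(m, n)).

Definition bilin (x : 'rV[F]_m) (y : 'rV[F]_n) : F := (x *m B *m y^T) 0 0.

Lemma bilinBl x x' y : bilin (x - x') y = bilin x y - bilin x' y.
Proof. by rewrite /bilin !mulmxBl [LHS]mxE [X in _ + X = _]mxE. Qed.

Lemma bilinBr x y y' : bilin x (y - y') = bilin x y - bilin x y'.
Proof. by rewrite /bilin raddfB/= mulmxBr [LHS]mxE [X in _ + X = _]mxE. Qed.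

Lemma bilinZl a x y : bilin (a *: x) y = a * bilin x y.
Proof. by rewrite /bilin -!scalemxAl mxE. Qed.

Lemma bilinZr a x y : bilin x (a *: y) = a * bilin x y.
Proof.
rewrite /bilin (_ : (a *: y)^T = a *: y^T); last by apply/matrixP=> i j; rewrite !mxE.
by rewrite -!scalemxAr mxE.
Qed.

Lemma bilin_delta i j : bilin (delta_mx 0 i) (delta_mx 0 j) = B i j.
Proof. by rewrite /bilin -rowE trmx_delta -colE !mxE. Qed.

End BilinearForm.

(** * Linear algebra: the trace inequality for Gram matrices *)

Section Trace.
(* [G] is the Gram matrix of a family [f], and [A] holds its inner products with
   an orthonormal family. Below, [H] is the Gram matrix of the family biorthogonal
   to [f], and [M] that of the residuals of [f] after orthogonal projection. *)
Variables (F : realFieldType) (K D : nat) (G : 'M[F]_K) (A : 'M[F]_(K, D)).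

Variables (delta2 kappa : F).
Hypotheses (delta2_gt0 : 0 < delta2) (kappa_gt0 : 0 < kappa).
Hypothesis Gsym : G^T = G.
Hypothesis psd : forall (x : 'rV[F]_K) (y : 'rV[F]_D),
  0 <= bilin G x x + 2 * bilin A x y + (y *m y^T) 0 0.
Hypothesis sep : forall (x : 'rV[F]_K) i, x 0 i = 1 ->
  delta2 <= bilin G x x.
Hypothesis approx : forall i, exists y : 'rV[F]_D,
  G i i - 2 * (row i A *m y^T) 0 0 + (y *m y^T) 0 0 <= kappa ^+ 2 * delta2.

(** Rescaling makes some coordinate equal to 1, where [sep] applies. Hence [G] is definite, and so
    invertible. *)
Lemma gram_pos (x : 'rV[F]_K) : x != 0 -> 0 < bilin G x x.
Proof.
move=> x0; have /rV0Pn[i xi0] := x0.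
have := @sep ((x 0 i)^-1 *: x) i.
rewrite mxE mulVf// => /(_ erefl).
rewrite bilinZl bilinZr => h.
rewrite -(pmulr_rgt0 _ (_ : 0 < (x 0 i)^-1 ^+ 2)); last by rewrite exprn_even_gt0//= invr_eq0.
by apply: lt_le_trans delta2_gt0 _; rewrite expr2 -mulrA.
Qed.

Lemma gram_unit : G \in unitmx.
Proof.
rewrite -row_free_unit; apply/row_freeP.
suff: row_free G by move=> /row_freeP.
apply: contraT; rewrite -kermx_eq0 => /rowV0Pn[x /sub_kermxP xG x0].
by have := gram_pos x0; rewrite /bilin xG mul0mx mxE ltxx.
Qed.

Let H := invmx G.

Let Hsym : H^T = H.
Proof. by rewrite /H trmx_inv Gsym. Qed.

Let HG : H *m G = 1%:M. Proof. exact: mulVmx gram_unit. Qed.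
Let GH : G *m H = 1%:M. Proof. exact: mulmxV gram_unit. Qed.

Lemma row_invG i : row i H *m G = row i 1%:M.
Proof. by rewrite -row_mul HG. Qed.

(** Row [i] of [H] holds the coefficients of the [i]-th biorthogonal vector, and [H i i] is its
    squared norm. Dividing the row by [H i i] makes its [i]-th coefficient 1 and its squared norm
    [(H i i)^-1], which [sep] bounds below. *)
Lemma invG_diag i : 0 < H i i <= delta2^-1.
Proof.
have v0 : row i H != 0.
  apply: contraTneq isT => /(congr1 (fun v => (v *m G) 0 i)).
  by rewrite row_invG mul0mx !mxE eqxx => /eqP; rewrite oner_eq0.
have e : bilin G (row i H) (row i H) = H i i.
  by rewrite /bilin row_invG row1 -rowE !mxE.
have h0 : 0 < H i i by rewrite -e gram_pos.
rewrite h0/=.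
have := @sep ((H i i)^-1 *: row i H) i.
rewrite !mxE mulVf ?gt_eqF// => /(_ erefl).
rewrite bilinZl bilinZr e mulVf ?gt_eqF// mulr1.
by move=> h; rewrite -[leLHS]invrK lef_pV2// posrE invr_gt0.
Qed.

Let M := G - A *m A^T.

Lemma schur_psd (x : 'rV[F]_K) : 0 <= bilin M x x.
Proof.
have := psd x (- (x *m A)).
rewrite /bilin linearN/= mulNmx !mulmxN opprK !trmx_mul !mulmxA.
rewrite /M mulmxBr mulmxBl !mulmxA !mxE; lra.
Qed.

(** The orthogonal projection is the best approximation: the error of any [y] exceeds that of
    [row i A] by the squared norm of [y - row i A]. *)
Lemma schur_diag i : M i i <= kappa ^+ 2 * delta2.
Proof.
have [y hy] := approx i; apply: le_trans hy.
pose z := y - row i A.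
have : 0 <= (z *m z^T) 0 0.
  by rewrite mxE; apply: sumr_ge0 => j _; rewrite !mxE -expr2 sqr_ge0.
rewrite /z linearB/= mulmxBr !mulmxBl.
have -> : y *m (row i A)^T = (row i A *m y^T)^T by rewrite trmx_mul trmxK.
have -> : M i i = G i i - (row i A *m (row i A)^T) 0 0.
  by rewrite /M !mxE; congr (_ - _); apply: eq_bigr => j _; rewrite !mxE.
rewrite !mxE; lra.
Qed.

(** The [k]-th diagonal entry is the squared norm of the projection of the [k]-th orthonormal vector
    to the span of [f], hence at most 1. It suffices to apply [psd] to that vector minus its
    projection. *)
Lemma trace_le_dim : \tr (A^T *m H *m A) <= D%:R.
Proof.
rewrite -[D in D%:R]card_ord -sumr_const; apply: ler_sum => k _.
pose c := row k A^T.
have := psd (- (c *m H)) (delta_mx 0 k); rewrite /bilin.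
have -> : (A^T *m H *m A) k k = (c *m H *m c^T) 0 0.
  have -> : c^T = col k A by rewrite /c tr_row trmxK.
  by rewrite -bilin_delta /bilin /c rowE colE trmx_delta !mulmxA.
have -> : delta_mx 0 k *m (delta_mx 0 k)^T = 1%:M :> 'M[F]_1.
  by rewrite trmx_delta mul_delta_mx; apply/matrixP=> i j; rewrite !ord1 !mxE.
rewrite linearN/= !mulNmx mulmxN opprK trmx_mul Hsym !mulmxA.
rewrite -(mulmxA _ H G) HG mulmx1 trmx_delta -(mulmxA _ A) -colE.
have -> : col k A = c^T by rewrite /c tr_row trmxK.
set q := (c *m H *m c^T) 0 0.
rewrite (_ : (- (c *m H *m c^T)) 0 0 = - q); last by rewrite mxE.
rewrite (_ : (1%:M : 'M[F]_1) 0 0 = 1); last by rewrite mxE eqxx.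
by rewrite -/q; lra.
Qed.

(** Cauchy-Schwarz for the semidefinite form [M]: the residual of the [i]-th vector has norm at most
    [kappa * delta], that of the [i]-th biorthogonal vector at most [1 / delta]. *)
Lemma schur_invG i : (M *m H) i i <= kappa.
Proof.
pose u : 'rV[F]_K := delta_mx 0 i; pose v := row i H.
(* The quotient of the two norm bounds. With this [s] both square terms of the form at [u - s *: v]
   are at most [kappa * s], and no square root is taken. *)
pose s := kappa * delta2.
have s0 : 0 < s by rewrite mulr_gt0.
have Msym : M^T = M by rewrite /M linearB/= trmx_mul trmxK Gsym.
have uMv : bilin M u v = (M *m H) i i.
  by rewrite -[RHS]bilin_delta /bilin /v tr_row Hsym colE trmx_delta !mulmxA.
have vMu : bilin M v u = (M *m H) i i.
  rewrite -uMv /bilin -[in RHS](trmxK (u *m M *m v^T)) [RHS]mxE.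
  by rewrite trmx_mul trmxK trmx_mul Msym mulmxA.
have vMv : bilin M v v <= delta2^-1.
  have /andP[_] := invG_diag i; apply: le_trans.
  have -> : H i i = bilin G v v.
    by rewrite /bilin row_invG row1 -rowE !mxE.
  have : 0 <= ((v *m A) *m (v *m A)^T) 0 0.
    by rewrite mxE; apply: sumr_ge0 => j _; rewrite !mxE -expr2 sqr_ge0.
  rewrite trmx_mul !mulmxA /bilin /M mulmxBr mulmxBl !mulmxA => h.
  by rewrite [leLHS]mxE [X in _ + X]mxE gerBl.
have := schur_psd (u - s *: v).
rewrite bilinBl !bilinBr !bilinZl !bilinZr uMv vMu bilin_delta.
have := schur_diag i; set mh := (M *m H) i i; set mii := M i i.
have : s * (s * bilin M v v) <= kappa * s.
  rewrite (_ : kappa * s = s * (s * delta2^-1)); last first.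
    by rewrite /s mulrCA mulfK ?gt_eqF// mulrC.
  by rewrite !ler_pM2l.
rewrite (_ : kappa ^+ 2 * delta2 = kappa * s); last by rewrite /s expr2 mulrA.
move=> h1 h2 h3; rewrite -(ler_pM2r s0); lra.
Qed.

(** By cyclicity, the trace of [A^T *m H *m A] is that of [(G - M) *m H], that is [K] minus the
    trace of [M *m H]. *)
Lemma trace_bound : K%:R * (1 - kappa) <= D%:R.
Proof.
apply: le_trans trace_le_dim.
have e : \tr (A^T *m H *m A) = K%:R - \tr (M *m H).
  rewrite /M mulmxBl linearB/= GH mxtrace1; rewrite opprB addrC subrK.
  by rewrite -mulmxA mxtrace_mulC -mulmxA mxtrace_mulC.
rewrite e mulrBr mulr1 lerD2l lerN2 mulr_natl -[K in kappa *+ K]card_ord -sumr_const.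
by apply: ler_sum => i _; exact: schur_invG.
Qed.

End Trace.

(** * Translation invariance, measurability and the squared L^2 norm *)

Section Norm.
Variable R : realType.
Local Notation mu := (@lebesgue_measure R).
Local Notation cfun := (cfun R).

(** By uniqueness of Lebesgue measure, half-open intervals suffice. *)
Lemma lebesgue_measure_translate (a : R) (A : set R) : measurable A ->
  pushforward mu (fun x : measurableTypeR R => x - a : measurableTypeR R) A = mu A.
Proof.
have mphi : measurable_fun [set: measurableTypeR R]
    (fun x => x - a : measurableTypeR R).
  by apply: measurable_funB => //; exact: measurable_cst.
pose h := isMeasurableFun.Build _ _ _ _ _ mphi.
pose phi : {mfun measurableTypeR R >-> measurableTypeR R} := HB.pack (fun x => x - a) h.
move=> mA; rewrite -[LHS]/(pushforward mu phi A); apply/esym.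
apply: lebesgue_measure_unique => // X [[p q] _ <-].
have e : (fun x => x - a) @^-1` `]p, q] = `]p + a, q + a]%classic.
  by apply/seteqP; split=> x /=; rewrite !in_itv/= ltrBrDr lerBlDr.
transitivity (mu `]p + a, q + a]%classic); last by rewrite -e.
rewrite !lebesgue_measure_itv/= !lte_fin ltrD2r; case: ifP => // _.
by rewrite -!EFinB; congr (_%:E); ring.
Qed.

Lemma ge0_integral_translate (a : R) (f : R -> \bar R) :
  measurable_fun setT f -> (forall x, 0 <= f x)%E ->
  (\int[mu]_x f (x - a)%R = \int[mu]_x f x)%E.
Proof.
move=> mf f0.
have mphi : measurable_fun [set: measurableTypeR R]
    (fun x => x - a : measurableTypeR R).
  by apply: measurable_funB => //; exact: measurable_cst.
have := ge0_integral_pushforward mphi mu measurableT mf.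
rewrite preimage_setT => <- //.
apply: eq_measure_integral => A mA _; exact: lebesgue_measure_translate.
Qed.

Implicit Types f h u v : cfun.

(** Kept apart from [L2]: [normsq] is extended-real valued, so its estimates need measurability but
    no finiteness. *)
Definition meas2 (f : cfun) :=
  measurable_fun setT (fun t => (f t).1) /\ measurable_fun setT (fun t => (f t).2).

Definition cadf (f h : cfun) : cfun :=
  fun t => ((f t).1 + (h t).1, (f t).2 + (h t).2).
Definition cscale (a : R) (f : cfun) : cfun := fun t => (a * (f t).1, a * (f t).2).
Definition lc (I : finType) (x : I -> R) (w : I -> cfun) : cfun :=
  fun t => (\sum_i x i * (w i t).1, \sum_i x i * (w i t).2).

Lemma meas2_add f h : meas2 f -> meas2 h -> meas2 (cadf f h).
Proof. by move=> [? ?] [? ?]; split; apply: measurable_funD. Qed.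

Lemma meas2_sub f h : meas2 f -> meas2 h -> meas2 (csub f h).
Proof. by move=> [? ?] [? ?]; split; apply: measurable_funB. Qed.

Lemma meas2_scale a f : meas2 f -> meas2 (cscale a f).
Proof. by move=> [? ?]; split; apply: measurable_funM => //; exact: measurable_cst. Qed.

Lemma meas2_lc (I : finType) (x : I -> R) (w : I -> cfun) :
  (forall i, meas2 (w i)) -> meas2 (lc x w).
Proof.
move=> mw; split; apply: measurable_sum => i; apply: measurable_funM;
  by [exact: measurable_cst | case: (mw i)].
Qed.

Lemma meas2_translate a f : meas2 f -> meas2 (fun t => f (t - a)).
Proof.
have m : measurable_fun [set: R] (fun x : R => x - a).
  by apply: measurable_funB => //; exact: measurable_cst.
by case=> [m1 m2]; split; [exact: (measurableT_comp m1 m) | exact: (measurableT_comp m2 m)].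
Qed.

Lemma meas2_expi b : meas2 (fun t => cexpi (2 * pi * b * t)).
Proof.
have m : measurable_fun [set: R] (fun x : R => 2 * pi * b * x).
  by apply: measurable_funM => //; exact: measurable_cst.
split; apply: measurableT_comp m; apply: continuous_measurable_fun.
  exact: continuous_cos.
exact: continuous_sin.
Qed.

Lemma meas2_mul f h : meas2 f -> meas2 h -> meas2 (fun t => cmul (f t) (h t)).
Proof.
by move=> [? ?] [? ?]; split; [apply: measurable_funB|apply: measurable_funD];
  apply: measurable_funM.
Qed.

Lemma meas2_gabor f ab : meas2 f -> meas2 (gabor f ab).
Proof.
by move=> mf; apply: meas2_mul; [exact: meas2_expi|exact: meas2_translate].
Qed.

Definition sqn (f : cfun) (t : R) := (f t).1 ^+ 2 + (f t).2 ^+ 2.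

Lemma sqn_ge0 f t : 0 <= sqn f t.
Proof. by rewrite addr_ge0// sqr_ge0. Qed.

Lemma meas2_sqn f : meas2 f -> measurable_fun setT (fun t => (sqn f t)%:E).
Proof.
case=> m1 m2; apply/measurable_EFinP; apply: measurable_funD; exact: measurable_funX.
Qed.

Lemma normsq_ge0 f : (0 <= normsq f)%E.
Proof. by rewrite /normsq; apply: integral_ge0 => t _; rewrite lee_fin; exact: sqn_ge0. Qed.

Lemma normsq_gabor f ab : meas2 f -> normsq (gabor f ab) = normsq f.
Proof.
move=> mf; rewrite /normsq -(ge0_integral_translate ab.1 (meas2_sqn mf)); last first.
  by move=> x; rewrite lee_fin sqn_ge0.
apply: eq_integral => t _; congr (_%:E); rewrite /sqn /gabor /cmul /=.
set c := cos _; set s := sin _.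
have : c ^+ 2 + s ^+ 2 = 1 by exact: cos2Dsin2.
set x := (f _).1; set y := (f _).2 => cs.
transitivity ((c ^+ 2 + s ^+ 2) * (x ^+ 2 + y ^+ 2)); first by ring.
by rewrite cs mul1r.
Qed.

Lemma le_normsq f h : meas2 f -> meas2 h -> (forall t, sqn f t <= sqn h t) ->
  (normsq f <= normsq h)%E.
Proof.
move=> mf mh fh; rewrite /normsq; apply: ge0_le_integral => //.
- by move=> t _; rewrite lee_fin; exact: sqn_ge0.
- exact: meas2_sqn.
- exact: meas2_sqn.
- by move=> t _; rewrite lee_fin; exact: fh.
Qed.

Lemma normsq_le_add f u v : meas2 f -> meas2 u -> meas2 v ->
  (forall t, sqn f t <= 2 * sqn u t + 2 * sqn v t) ->
  (normsq f <= 2%:E * normsq u + 2%:E * normsq v)%E.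
Proof.
move=> mf mu' mv fuv.
have mg w : meas2 w -> measurable_fun setT (fun t => (2%:E * (sqn w t)%:E)%E).
  by move=> mw; apply: emeasurable_funM; [exact: measurable_cst|exact: meas2_sqn].
have g0 w t : (0 <= 2%:E * (sqn w t)%:E)%E.
  by rewrite -EFinM lee_fin mulr_ge0// sqn_ge0.
rewrite /normsq -!ge0_integralZl_EFin//; try exact: meas2_sqn.
- rewrite -ge0_integralD//; try exact: mg.
  + apply: ge0_le_integral => //.
    * by move=> t _; rewrite lee_fin; exact: sqn_ge0.
    * exact: meas2_sqn.
    * by apply: emeasurable_funD; exact: mg.
    * by move=> t _; rewrite -!EFinM -EFinD lee_fin; exact: fuv.
  + by move=> t _; exact: g0.
  + by move=> t _; exact: g0.
- by move=> t _; rewrite lee_fin; exact: sqn_ge0.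
- by move=> t _; rewrite lee_fin; exact: sqn_ge0.
Qed.

Lemma normsq_scale a f : meas2 f -> normsq (cscale a f) = ((a ^+ 2)%:E * normsq f)%E.
Proof.
move=> mf; rewrite /normsq -ge0_integralZl_EFin ?sqr_ge0//; last 2 first.
- by move=> t _; rewrite lee_fin; exact: sqn_ge0.
- exact: meas2_sqn.
by apply: eq_integral => t _ /=; rewrite -EFinM; congr (_%:E); ring.
Qed.

End Norm.

(** * The real inner product and the passage from functions to matrices *)

Section Inner.
Variable R : realType.
Local Notation mu := (@lebesgue_measure R).
Local Notation cfun := (cfun R).
Implicit Types f h u v : cfun.

Definition dot f h (t : R) : R := (f t).1 * (h t).1 + (f t).2 * (h t).2.

Definition ip f h : R := \int[mu]_t dot f h t.

Lemma L2_meas2 f : L2 f -> meas2 f.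
Proof. by case=> m1 [m2 _]. Qed.

Lemma L2P f : meas2 f -> (normsq f < +oo)%E -> L2 f.
Proof. by case. Qed.

Lemma normsq_add_le f h : meas2 f -> meas2 h ->
  (normsq (cadf f h) <= 2%:E * normsq f + 2%:E * normsq h)%E.
Proof.
move=> mf mh; apply: normsq_le_add => //; first exact: meas2_add.
move=> t; rewrite /sqn/=; set a := (f t).1; set b := (f t).2.
set c := (h t).1; set d := (h t).2.
have := sqr_ge0 (a - c); have := sqr_ge0 (b - d); rewrite !sqrrB !sqrrD; lra.
Qed.

Lemma L2_add f h : L2 f -> L2 h -> L2 (cadf f h).
Proof.
move=> f2 h2; have mf := L2_meas2 f2; have mh := L2_meas2 h2.
apply: L2P; first exact: meas2_add.
apply: le_lt_trans (normsq_add_le mf mh) _.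
have [_ [_ nf]] := f2; have [_ [_ nh]] := h2.
by apply: lte_add_pinfty; apply: lte_mul_pinfty.
Qed.

Lemma L2_scale a f : L2 f -> L2 (cscale a f).
Proof.
move=> f2; have mf := L2_meas2 f2; apply: L2P; first exact: meas2_scale.
rewrite normsq_scale//; apply: lte_mul_pinfty => //; last by case: f2 => _ [].
by rewrite lee_fin sqr_ge0.
Qed.

Lemma L2_0 : L2 (fun=> (0, 0) : cplx R).
Proof.
apply: L2P; first by split; exact: measurable_cst.
rewrite /normsq (eq_integral (fun=> 0%E)) ?integral0// => t _.
by rewrite expr0n/= addr0.
Qed.

Lemma sqn_integrable f : L2 f -> mu.-integrable setT (fun t => (sqn f t)%:E).
Proof.
move=> f2; apply/integrableP; split; first exact: meas2_sqn (L2_meas2 f2).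
under eq_integral do rewrite gee0_abs ?lee_fin ?sqn_ge0//.
by case: f2 => _ [].
Qed.

Lemma dot_integrable f h : L2 f -> L2 h -> mu.-integrable setT (EFin \o dot f h).
Proof.
move=> f2 h2; have mf := L2_meas2 f2; have mh := L2_meas2 h2.
apply: (@le_integrable _ _ _ mu _ measurableT _
  ((fun t => (sqn f t)%:E) \+ (fun t => (sqn h t)%:E))%E).
- apply/measurable_EFinP; case: mf => ? ?; case: mh => ? ?.
  by apply: measurable_funD; apply: measurable_funM.
- move=> t _; rewrite -EFinD !abse_EFin lee_fin [leRHS]ger0_norm; last first.
    by rewrite addr_ge0// sqn_ge0.
  rewrite /dot /sqn; set a := (f t).1; set b := (f t).2.
  set c := (h t).1; set d := (h t).2.
  have := sqr_ge0 (a - c); have := sqr_ge0 (b - d).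
  have := sqr_ge0 (a + c); have := sqr_ge0 (b + d).
  have := sqr_ge0 a; have := sqr_ge0 b; have := sqr_ge0 c; have := sqr_ge0 d.
  by rewrite !sqrrB !sqrrD => *; rewrite ler_norml; apply/andP; split; lra.
- by apply: integrableD => //; exact: sqn_integrable.
Qed.

Lemma normsq_ip f : L2 f -> normsq f = (ip f f)%:E.
Proof.
move=> f2; rewrite /ip /Rintegral fineK; last first.
  exact: integrable_fin_num (dot_integrable f2 f2).
by apply: eq_integral => t _; rewrite /dot -!expr2.
Qed.

Lemma ip_sym f h : ip f h = ip h f.
Proof. by apply: eq_Rintegral => t _; rewrite /dot ![_ * (h t).1]mulrC ![_ * (h t).2]mulrC. Qed.

Lemma ip_add u v h : L2 u -> L2 v -> L2 h -> ip (cadf u v) h = ip u h + ip v h.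
Proof.
move=> u2 v2 h2; rewrite /ip -RintegralD//; [|exact: dot_integrable..].
by apply: eq_Rintegral => t _; rewrite /dot/=; ring.
Qed.

Lemma ip_scale a u h : L2 u -> L2 h -> ip (cscale a u) h = a * ip u h.
Proof.
move=> u2 h2; rewrite /ip -RintegralZl//; last exact: dot_integrable.
by apply: eq_Rintegral => t _; rewrite /dot/=; ring.
Qed.

Lemma ip_sub u v h : L2 u -> L2 v -> L2 h -> ip (csub u v) h = ip u h - ip v h.
Proof.
move=> u2 v2 h2; rewrite -[X in _ + X]mulN1r -ip_scale// -ip_add//; last exact: L2_scale.
by congr ip; apply/funext => t; rewrite /csub /cadf/= !mulN1r.
Qed.

Lemma csubE u v : csub u v = cadf u (cscale (-1) v).
Proof. by apply/funext => t; rewrite /csub /cadf/= !mulN1r. Qed.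

Lemma L2_sub f h : L2 f -> L2 h -> L2 (csub f h).
Proof. by move=> ? ?; rewrite csubE; apply: L2_add => //; exact: L2_scale. Qed.

Lemma lc_ind (I : finType) (P : cfun -> Prop) (x : I -> R) (w : I -> cfun) :
  P (fun=> (0, 0)) -> (forall i f, P f -> P (cadf (cscale (x i) (w i)) f)) ->
  P (lc x w).
Proof.
move=> P0 PS; rewrite /lc; elim: (index_enum I) => [|i s ih].
  by under eq_fun do rewrite !big_nil.
under eq_fun do rewrite !big_cons.
exact: (PS i _ ih).
Qed.

Lemma L2_lc (I : finType) (x : I -> R) (w : I -> cfun) :
  (forall i, L2 (w i)) -> L2 (lc x w).
Proof.
move=> w2; apply: lc_ind; first exact: L2_0.
by move=> i f f2; apply: L2_add => //; exact: L2_scale.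
Qed.

Lemma ip_lc (I : finType) (x : I -> R) (w : I -> cfun) h :
  (forall i, L2 (w i)) -> L2 h -> ip (lc x w) h = \sum_i x i * ip (w i) h.
Proof.
move=> w2 h2; rewrite /lc.
suff H s : let f := fun t : R => (\sum_(i <- s) x i * (w i t).1,
   \sum_(i <- s) x i * (w i t).2) in
   L2 f /\ ip f h = \sum_(i <- s) x i * ip (w i) h.
  exact: (H _).2.
elim: s => [|i s [ihL ih]] /=.
  under eq_fun do rewrite !big_nil.
  split; first exact: L2_0.
  rewrite big_nil /ip /dot /=; under eq_Rintegral do rewrite !mul0r addr0.
  by rewrite Rintegral_cst// mul0r.
under eq_fun do rewrite !big_cons.
have wi2 := L2_scale (x i) (w2 i); split; first exact: (L2_add wi2 ihL).
by rewrite big_cons -ih -ip_scale//; exact: (ip_add wi2 ihL h2).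
Qed.

Lemma normsq_csub f h : L2 f -> L2 h ->
  normsq (csub f h) = (ip f f - 2 * ip f h + ip h h)%:E.
Proof.
move=> f2 h2; rewrite normsq_ip; last exact: L2_sub.
have fh2 := L2_sub f2 h2.
rewrite ip_sub// (ip_sym f (csub f h)) (ip_sym h (csub f h)).
rewrite !ip_sub// (ip_sym h f).
by congr (_%:E); ring.
Qed.

Lemma ip_lc2 (I J : finType) (x : I -> R) (y : J -> R) (f : I -> cfun) (e : J -> cfun) :
  (forall i, L2 (f i)) -> (forall j, L2 (e j)) ->
  ip (lc x f) (lc y e) = \sum_i x i * \sum_j y j * ip (f i) (e j).
Proof.
move=> f2 e2; rewrite ip_lc//; last exact: L2_lc.
by apply: eq_bigr => i _; rewrite ip_sym ip_lc//; under eq_bigr do rewrite ip_sym.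
Qed.

Lemma bilin_ip (K D : nat) (x : 'rV[R]_K) (y : 'rV[R]_D) (f : 'I_K -> cfun)
    (e : 'I_D -> cfun) : (forall i, L2 (f i)) -> (forall j, L2 (e j)) ->
  bilin (\matrix_(i, j) ip (f i) (e j)) x y = ip (lc (x 0) f) (lc (y 0) e).
Proof.
move=> f2 e2; rewrite ip_lc2// /bilin -mulmxA mxE; apply: eq_bigr => i _.
congr (_ * _); rewrite mxE; apply: eq_bigr => j _.
by rewrite !mxE mulrC.
Qed.

(** This is [trace_bound] for Gram matrices of functions: bilinear forms of matrices become inner
    products of linear combinations. *)
Lemma separated_card_le_ord (K D : nat) (f : 'I_K -> cfun) (e : 'I_D -> cfun)
    (d2 kappa : R) : 0 < d2 -> 0 < kappa ->
  (forall i, L2 (f i)) -> (forall j, L2 (e j)) ->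
  (forall j k, ip (e j) (e k) = (j == k)%:R) ->
  (forall (x : 'I_K -> R) i, x i = 1 -> (d2%:E <= normsq (lc x f))%E) ->
  (forall i, exists c : 'I_D -> R,
    (normsq (csub (f i) (lc c e)) <= (kappa ^+ 2 * d2)%:E)%E) ->
  K%:R * (1 - kappa) <= D%:R.
Proof.
move=> d20 k0 f2 e2 on sep appr.
have idE (y : 'rV[R]_D) : (y *m y^T) 0 0 = ip (lc (y 0) e) (lc (y 0) e).
  rewrite -bilin_ip// /bilin (_ : (\matrix_(i, j) _) = 1%:M) ?mulmx1//.
  by apply/matrixP => i j; rewrite !mxE on.
pose G : 'M[R]_K := \matrix_(i, j) ip (f i) (f j).
pose A : 'M[R]_(K, D) := \matrix_(i, j) ip (f i) (e j).
apply: (@trace_bound _ _ _ G A d2) => //.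
- by apply/matrixP => i j; rewrite !mxE ip_sym.
- move=> x y; rewrite !bilin_ip// idE.
  have F2 : L2 (lc (x 0) f) by exact: L2_lc.
  have E2 : L2 (lc (y 0) e) by exact: L2_lc.
  (* [psd] is the positivity of the squared norm of a sum, here a difference with the sign absorbed
     by [cscale (-1)]. *)
  have := normsq_ge0 (csub (lc (x 0) f) (cscale (-1) (lc (y 0) e))).
  have E2' := L2_scale (-1) E2.
  rewrite normsq_csub// lee_fin ip_scale// (ip_sym (lc (x 0) f)) ip_scale//.
  by rewrite (ip_sym (lc (y 0) e) (cscale _ _)) ip_scale// (ip_sym (lc (y 0) e) (lc _ f)); lra.
- move=> x i xi; rewrite bilin_ip// -lee_fin -normsq_ip; last exact: L2_lc.
  exact: sep xi.
- move=> i; have [c] := appr i; rewrite normsq_csub//; last exact: L2_lc.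
  rewrite lee_fin => hc; exists (\row_j c j).
  have lcc : lc ((\row_j c j) 0) e = lc c e.
    by congr lc; apply/funext => j; rewrite mxE.
  rewrite idE lcc; apply: le_trans hc; rewrite !mxE lerD2r lerD2l lerN2.
  rewrite ip_sym ip_lc// ler_pM2l// le_eqVlt; apply/orP; left; apply/eqP.
  by apply: eq_bigr => j _; rewrite !mxE mulrC ip_sym.
Qed.

Lemma lc_enum (I : finType) (x : I -> R) (w : I -> cfun) :
  lc x w = lc (x \o @enum_val I predT) (w \o @enum_val I predT).
Proof.
by apply/funext => t; rewrite /lc /=; congr pair;
  rewrite (reindex _ (onW_bij _ (@enum_val_bij I))).
Qed.

Lemma separated_card_le (I J : finType) (f : I -> cfun) (e : J -> cfun)
    (d2 kappa : R) : 0 < d2 -> 0 < kappa ->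
  (forall i, L2 (f i)) -> (forall j, L2 (e j)) ->
  (forall j k, ip (e j) (e k) = (j == k)%:R) ->
  (forall (x : I -> R) i, x i = 1 -> (d2%:E <= normsq (lc x f))%E) ->
  (forall i, exists c : J -> R,
    (normsq (csub (f i) (lc c e)) <= (kappa ^+ 2 * d2)%:E)%E) ->
  #|I|%:R * (1 - kappa) <= #|J|%:R :> R.
Proof.
move=> d20 k0 f2 e2 on sep appr.
apply: (@separated_card_le_ord _ _ (f \o @enum_val I predT) (e \o @enum_val J predT) d2) => //=.
- by move=> j k; rewrite on (inj_eq enum_val_inj).
- move=> x i xi; have := sep (x \o enum_rank) (enum_val i).
  rewrite lc_enum /= enum_valK => /(_ xi).
  suff -> : (x \o enum_rank) \o @enum_val I predT = x by [].
  by apply/funext => j /=; rewrite enum_valK.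
- by move=> i; have [c] := appr (enum_val i); rewrite lc_enum; exists (c \o enum_val).
Qed.

End Inner.

(** * Finite cosine sums and discrete Fourier coefficients *)

Section Trigonometric.
Variable R : realType.
Implicit Types (t a p : R).

Lemma cos_lipschitz a p : `|cos a - cos p| <= `|a - p|.
Proof.
wlog ap : a p / p < a => [h|].
  have [/h//|/h|->] := ltgtP p a; last by rewrite !subrr normr0.
  by rewrite distrC (distrC p).
have [|c _ ->] := @MVT R cos (fun x => - sin x) p a ap.
  by apply: continuous_subspaceT => x; exact: continuous_cos.
by rewrite normrM normrN ler_piMl// ler_norml sin_geN1 sin_le1.
Qed.

Lemma sin_lipschitz a p : `|sin a - sin p| <= `|a - p|.
Proof.
rewrite -!cosBpihalf; apply: le_trans (cos_lipschitz _ _) _.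
by rewrite opprB addrA subrK.
Qed.

Lemma cos_half_ge t : 0 <= t <= pi / 4 -> 1 / 2 <= cos t.
Proof.
move=> /andP[t0 t4]; have p0 := pi_gt0 R.
have c0 : 0 <= cos t by apply: cos_ge0_pihalf; apply/andP; split; lra.
have : 0 <= cos (t *+ 2) by apply: cos_ge0_pihalf; rewrite (mulr2n t); apply/andP; split; lra.
rewrite cos_mulr2n (mulr2n (cos t ^+ 2)) => h; rewrite leNgt; apply/negP => h'.
have : cos t ^+ 2 < (1 / 2) ^+ 2 by rewrite ltr_pXn2r// nnegrE; lra.
rewrite !expr2 in h *; lra.
Qed.

(** A crude Jordan inequality. The mean value theorem is applied at [t / 2], because the cosine
    stays above [1 / 2] up to [pi / 4] but vanishes at [pi / 2]; the double-angle formula then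
    returns to [t]. *)
Lemma sin_ge_quarter t : 0 <= t <= pi / 2 -> t / 4 <= sin t.
Proof.
move=> /andP[]; rewrite le_eqVlt => /predU1P[<- _|t0 t2].
  by rewrite mul0r sin0.
have v0 : 0 < t / 2 by rewrite divr_gt0.
have c2 : 1 / 2 <= cos (t / 2) by apply: cos_half_ge; apply/andP; split; lra.
have s2 : t / 4 <= sin (t / 2).
  have [|c] := @MVT R sin cos 0 (t / 2) v0.
    by apply: continuous_subspaceT => x; exact: continuous_sin.
  rewrite in_itv/= => /andP[c0 ct]; rewrite sin0 !subr0 => ->.
  have : 1 / 2 <= cos c by apply: cos_half_ge; apply/andP; split; lra.
  move=> /(ler_wpM2r (ltW v0)); lra.
rewrite [X in sin X](_ : t = (t / 2) *+ 2); last by rewrite -mulr_natr divfK.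
rewrite sin_mulr2n (mulr2n (cos (t / 2) * _)).
have : 1 / 2 * (t / 4) <= cos (t / 2) * sin (t / 2).
  by apply: ler_pM => //; lra.
lra.
Qed.

(** The Dirichlet kernel: the product [2 sin cos] is a difference of sines at consecutive
    half-integers. *)
Lemma sum_cos_tele t p (m n : nat) : (m <= n)%N ->
  2 * sin (t / 2) * (\sum_(m <= j < n) cos (t * j%:R + p)) =
  sin (t * (n%:R - 1 / 2) + p) - sin (t * (m%:R - 1 / 2) + p).
Proof.
move=> mn; rewrite mulr_sumr.
rewrite (eq_bigr (fun j => sin (t * (j.+1%:R - 1 / 2) + p) - sin (t * (j%:R - 1 / 2) + p))).
  by rewrite telescope_sumr.
move=> j _; rewrite -[j.+1%:R]natr1.
have -> : t * (j%:R + 1 - 1 / 2) + p = (t * j%:R + p) + t / 2 by field.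
have -> : t * (j%:R - 1 / 2) + p = (t * j%:R + p) - t / 2 by field.
by rewrite sinD sinB; ring.
Qed.

Lemma sum_cos_le t p (m n : nat) : sin (t / 2) != 0 ->
  `|\sum_(m <= j < n) cos (t * j%:R + p)| <= `|sin (t / 2)|^-1.
Proof.
move=> s0; have [mn|/ltnW nm] := leqP m n; last by rewrite big_geq// normr0 invr_ge0.
have s0' : 0 < `|sin (t / 2)| by rewrite normr_gt0.
rewrite -div1r ler_pdivlMr// mulrC -normrM.
have := sum_cos_tele t p mn; set A := \sum_(_ <= _ < _) _ => h.
have -> : sin (t / 2) * A =
    (sin (t * (n%:R - 1 / 2) + p) - sin (t * (m%:R - 1 / 2) + p)) / 2.
  by rewrite -h; field.
have := sin_le1 (t * (n%:R - 1 / 2) + p); have := sin_geN1 (t * (n%:R - 1 / 2) + p).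
have := sin_le1 (t * (m%:R - 1 / 2) + p); have := sin_geN1 (t * (m%:R - 1 / 2) + p).
by move=> *; rewrite ler_norml; apply/andP; split; lra.
Qed.

Lemma sin_root_gt0 (k Q : nat) : (0 < k < Q)%N -> 0 < sin (2 * pi * k%:R / Q%:R / 2 : R).
Proof.
move=> /andP[k0 kQ]; have Q0 : (0 < Q%:R :> R) by rewrite ltr0n (leq_trans _ kQ).
have p0 := pi_gt0 R.
have -> : 2 * pi * k%:R / Q%:R / 2 = pi * (k%:R / Q%:R) :> R by field; rewrite gt_eqF.
apply: sin_gt0_pi; apply/andP; split.
  by rewrite mulr_gt0// divr_gt0// ltr0n.
by rewrite gtr_pMr// ltr_pdivrMr// mul1r ltr_nat.
Qed.

(** The two end terms of the telescoped sum differ by [k] full periods, while the factor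
    [sin (pi * k / Q)] is nonzero. *)
Lemma sum_cos_root (k Q : nat) p : (0 < k < Q)%N ->
  \sum_(0 <= j < Q) cos (2 * pi * k%:R / Q%:R * j%:R + p) = 0.
Proof.
move=> kQ; have s0 := sin_root_gt0 kQ.
have Q0 : (0 < Q%:R :> R) by case/andP: kQ => k0 kQ; rewrite ltr0n (leq_trans _ kQ).
have := sum_cos_tele (2 * pi * k%:R / Q%:R) p (leq0n Q).
have -> : 2 * pi * k%:R / Q%:R * (Q%:R - 1 / 2) + p =
   (2 * pi * k%:R / Q%:R * (0 - 1 / 2) + p) + pi *+ 2 *+ k.
  by rewrite -[pi *+ 2 *+ k]mulr_natr -[pi *+ 2]mulr_natr; field; rewrite gt_eqF.
rewrite (periodicn (@sinD2pi R)) subrr => /eqP; rewrite mulf_eq0 => /orP[|/eqP//].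
by rewrite mulf_eq0 pnatr_eq0 /= gt_eqF.
Qed.

Lemma sum_cos_ortho (k l Q : nat) p : (k < Q)%N -> (l < Q)%N ->
  \sum_(0 <= j < Q) cos (2 * pi * (k%:R - l%:R) / Q%:R * j%:R + p) =
  if k == l then Q%:R * cos p else 0.
Proof.
move=> kQ lQ; case: ltngtP => kl.
- rewrite -[RHS](@sum_cos_root (l - k) Q (- p)); last first.
    by rewrite subn_gt0 kl/= (leq_ltn_trans (leq_subr _ _)).
  apply: eq_bigr => j _; rewrite -cosN natrB; last exact: ltnW.
  by congr cos; ring.
- rewrite -[RHS](@sum_cos_root (k - l) Q p); last first.
    by rewrite subn_gt0 kl/= (leq_ltn_trans (leq_subr _ _)).
  by apply: eq_bigr => j _; rewrite natrB//; exact: ltnW.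
- rewrite kl subrr mulr0 mul0r; under eq_bigr do rewrite mul0r add0r.
  by rewrite sumr_const_nat subn0 mulr_natl.
Qed.

(* The inner product is the real part of the complex one: each exponential [e]
   contributes the two real-orthogonal vectors [e] and [i e], given by the phases
   [0] and [pi / 2]. *)
Definition phase (b : bool) : R := if b then pi / 2 else 0.

(** The angle at the [j]-th sample; [nu] is the lowest frequency of the window, in radians per cell.
    When [Q] cells cover a length [T], raising [k] by one raises the frequency by [1 / T]. *)
Definition wave (Q : nat) (nu : R) (kp : nat * bool) (j : nat) : R :=
  (nu + 2 * pi * kp.1%:R / Q%:R) * j%:R + phase kp.2.

Lemma wave_ortho Q nu (k l : nat) (b c : bool) : (k < Q)%N -> (l < Q)%N ->
  \sum_(0 <= j < Q) cos (wave Q nu (k, b) j - wave Q nu (l, c) j) =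
  Q%:R * ((k == l) && (b == c))%:R.
Proof.
move=> kQ lQ.
have -> : \sum_(0 <= j < Q) cos (wave Q nu (k, b) j - wave Q nu (l, c) j) =
  \sum_(0 <= j < Q) cos (2 * pi * (k%:R - l%:R) / Q%:R * j%:R + (phase b - phase c)).
  by apply: eq_bigr => j _; congr cos; rewrite /wave /=; ring.
rewrite sum_cos_ortho//; case: eqP => _ /=; last by rewrite mulr0.
congr (_ * _); case: b; case: c => /=; rewrite ?subrr ?cos0//.
  by rewrite subr0 cos_pihalf.
by rewrite sub0r cosN cos_pihalf.
Qed.

(** Up to normalization, the real inner product of a wave with the samples of a modulated indicator
    that is 1 exactly at the samples [lo <= j < hi]. *)
Definition dft (Q : nat) (nu al psi : R) (lo hi : nat) (kp : nat * bool) : R :=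
  \sum_(lo <= j < hi) cos (al * j%:R + psi - wave Q nu kp j).

(** The two phases give the real and imaginary parts of a geometric sum. Its squared modulus is
    expanded with [k] occurring linearly in the angle, ready for a summation over [k]. *)
Lemma dft_sq Q nu al psi lo hi k :
  dft Q nu al psi lo hi (k, false) ^+ 2 + dft Q nu al psi lo hi (k, true) ^+ 2 =
  \sum_(lo <= i < hi) \sum_(lo <= j < hi)
    cos (2 * pi * (j%:R - i%:R) / Q%:R * k%:R + (al - nu) * (i%:R - j%:R)).
Proof.
pose u j := al * j%:R + psi - wave Q nu (k, false) j.
have -> : dft Q nu al psi lo hi (k, false) = \sum_(lo <= j < hi) cos (u j) by [].
have -> : dft Q nu al psi lo hi (k, true) = \sum_(lo <= j < hi) sin (u j).
  by apply: eq_bigr => j _; rewrite -cosBpihalf; congr cos; rewrite /u /wave/=; ring.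
rewrite !expr2 !big_distrlr/= -big_split; apply: eq_bigr => i _.
rewrite -big_split; apply: eq_bigr => j _ /=; rewrite -cosB.
by congr cos; rewrite /u /wave/=; ring.
Qed.

(** After exchanging the sums, orthogonality over all [Q] frequencies leaves only the diagonal
    [i = j]. *)
Lemma dft_parseval Q nu al psi lo hi : (lo <= hi <= Q)%N ->
  \sum_(0 <= k < Q) (dft Q nu al psi lo hi (k, false) ^+ 2 +
                     dft Q nu al psi lo hi (k, true) ^+ 2) = Q%:R * (hi - lo)%:R.
Proof.
move=> /andP[lohi hiQ]; under eq_bigr do rewrite dft_sq.
rewrite exchange_big/= mulr_natr -sumr_const_nat big_nat [RHS]big_nat.
apply: eq_bigr => i /andP[loi ihi].
rewrite exchange_big/= big_nat (eq_bigr (fun j => if j == i then Q%:R else 0)).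
  rewrite -big_nat (bigD1_seq i) ?iota_uniq ?mem_index_iota ?loi//= eqxx.
  by rewrite big1 ?addr0// => j /negPf ->.
move=> j /andP[loj jhi].
rewrite sum_cos_ortho//; [|exact: leq_trans hiQ..].
by case: eqP => // ->; rewrite subrr mulr0 cos0 mulr1.
Qed.

(** Comparison with a telescoping sum, through [1 / y^2 <= 1 / (y - 1) - 1 / y] for [y > 1]. *)
Lemma sum_inv_sq (b : R) (m n : nat) : 1 < m%:R - b -> (m <= n)%N ->
  \sum_(m <= k < n) ((k%:R - b) ^+ 2)^-1 <= (m%:R - b - 1)^-1.
Proof.
move=> mb mn.
suff: \sum_(m <= k < n) ((k%:R - b) ^+ 2)^-1 <= (m%:R - b - 1)^-1 - (n%:R - b - 1)^-1.
  move=> /le_trans; apply; rewrite gerBl invr_ge0.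
  have : m%:R <= n%:R :> R by rewrite ler_nat.
  lra.
elim: n mn => [|n ih].
  by rewrite leqn0 => /eqP ->; rewrite big_geq// subrr.
rewrite leq_eqVlt => /predU1P[<-|]; first by rewrite big_geq// subrr.
rewrite ltnS => mn; rewrite big_nat_recr//=.
have mn' : m%:R <= n%:R :> R by rewrite ler_nat.
have y1 : 1 < n%:R - b by lra.
have -> : n.+1%:R - b - 1 = n%:R - b by rewrite -[n.+1%:R]natr1; ring.
set y := n%:R - b in y1 *; have := ih mn; rewrite -/y.
have : (y ^+ 2)^-1 <= (y - 1)^-1 - y^-1.
  have -> : (y - 1)^-1 - y^-1 = (y * (y - 1))^-1.
    by field; rewrite !gt_eqF//; lra.
  rewrite lef_pV2 ?posrE ?expr2; [|nra..].
  by nra.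
lra.
Qed.

Lemma sum_inv_sq_rev (b : R) (m n : nat) : 1 < b - n%:R -> (m <= n)%N ->
  \sum_(m <= k < n) ((b - k%:R) ^+ 2)^-1 <= (b - n%:R)^-1.
Proof.
move=> nb mn.
suff: \sum_(m <= k < n) ((b - k%:R) ^+ 2)^-1 <= (b - n%:R)^-1 - (b - m%:R)^-1.
  move=> /le_trans; apply; rewrite gerBl invr_ge0.
  have : m%:R <= n%:R :> R by rewrite ler_nat.
  lra.
elim: n nb mn => [|n ih] nb.
  by rewrite leqn0 => /eqP ->; rewrite big_geq// subrr.
rewrite leq_eqVlt => /predU1P[->|]; first by rewrite big_geq// subrr.
rewrite ltnS => mn; rewrite big_nat_recr//=.
have y1 : 1 < b - n%:R - 1 by move: nb; rewrite -[n.+1%:R]natr1; lra.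
have -> : b - n.+1%:R = b - n%:R - 1 by rewrite -[n.+1%:R]natr1; ring.
set y := b - n%:R in y1 *; have yn : 1 < y by lra.
have := ih yn mn; rewrite -/y.
have : (y ^+ 2)^-1 <= (y - 1)^-1 - y^-1.
  have -> : (y - 1)^-1 - y^-1 = (y * (y - 1))^-1.
    by field; rewrite !gt_eqF//; lra.
  rewrite lef_pV2 ?posrE ?expr2; [|nra..].
  by nra.
lra.
Qed.

(** The sine vanishes at both [y = 0] and [y = Q]. On each half it is at least a constant times the
    distance to the nearer zero; adding both terms spares the caller the case distinction. *)
Lemma inv_sin_sq_le (Q y : R) : 0 < y < Q ->
  (sin (pi * y / Q) ^+ 2)^-1 <= 4 * Q ^+ 2 * ((y ^+ 2)^-1 + ((Q - y) ^+ 2)^-1).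
Proof.
move=> /andP[y0 yQ]; have Q0 : 0 < Q by apply: lt_trans yQ.
have p0 := pi_gt0 R; have p2 := pi_ge2 R.
have key z : 0 < z -> z / (2 * Q) <= sin (pi * y / Q) ->
    (sin (pi * y / Q) ^+ 2)^-1 <= 4 * Q ^+ 2 * (z ^+ 2)^-1.
  move=> z0 zs; have zQ : 0 < z / (2 * Q) by rewrite divr_gt0// mulr_gt0.
  have -> : 4 * Q ^+ 2 * (z ^+ 2)^-1 = ((z / (2 * Q)) ^+ 2)^-1.
    by field; rewrite !gt_eqF.
  have s0 := lt_le_trans zQ zs.
  by rewrite lef_pV2 ?posrE ?exprn_gt0// ler_pXn2r// nnegrE ltW.
have [yh|yh] := leP (y / Q) (1 / 2).
- have : y / (2 * Q) <= sin (pi * y / Q).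
    apply: le_trans (@sin_ge_quarter (pi * y / Q) _).
      have -> : y / (2 * Q) = 2 * (y / Q) / 4 by field; rewrite gt_eqF.
      rewrite ler_pM2r// -mulrA ler_wpM2r// divr_ge0 ?ltW//.
    rewrite -mulrA mulr_ge0 ?divr_ge0 ?(ltW p0) ?(ltW y0) ?(ltW Q0)//=.
    by rewrite -(ler_pM2l p0) in yh; lra.
  move=> /(key _ y0)/le_trans; apply.
  by rewrite ler_pM2l ?mulr_gt0 ?exprn_gt0// lerDl invr_ge0 sqr_ge0.
- have Qy : 0 < Q - y by rewrite subr_gt0.
  have : (Q - y) / (2 * Q) <= sin (pi * y / Q).
    have -> : sin (pi * y / Q) = sin (pi * ((Q - y) / Q)).
      have -> : pi * ((Q - y) / Q) = pi - pi * y / Q by field; rewrite gt_eqF.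
      by rewrite sinB sinpi cospi; ring.
    apply: le_trans (@sin_ge_quarter _ _).
      have -> : (Q - y) / (2 * Q) = 2 * ((Q - y) / Q) / 4 by field; rewrite gt_eqF.
      rewrite ler_pM2r// ler_wpM2r// divr_ge0 ?ltW//.
    rewrite mulr_ge0 ?divr_ge0 ?(ltW p0) ?(ltW Qy) ?(ltW Q0)//=.
    have : (Q - y) / Q <= 1 / 2.
      have -> : (Q - y) / Q = 1 - y / Q by field; rewrite gt_eqF.
      lra.
    by rewrite -(ler_pM2l p0); lra.
  move=> /(key _ Qy)/le_trans; apply.
  by rewrite ler_pM2l ?mulr_gt0 ?exprn_gt0// lerDr invr_ge0 sqr_ge0.
Qed.

(** [be] locates the frequency [al] in bins counted from [nu]. The coefficient is a geometric sum of
    ratio angle [2 * pi * (be - k) / Q]. *)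
Lemma dft_le Q nu al psi lo hi k b (be : R) :
  al - nu = 2 * pi * be / Q%:R -> 0 < k%:R - be < Q%:R ->
  dft Q nu al psi lo hi (k, b) ^+ 2 <=
  4 * Q%:R ^+ 2 * (((k%:R - be) ^+ 2)^-1 + ((Q%:R + be - k%:R) ^+ 2)^-1).
Proof.
move=> alnu ky; have /andP[y0 yQ] := ky; have Q0 := lt_trans y0 yQ.
have := inv_sin_sq_le ky; rewrite opprB addrA; apply: le_trans.
set t := 2 * pi * (be - k%:R) / Q%:R.
have dE : dft Q nu al psi lo hi (k, b) =
    \sum_(lo <= j < hi) cos (t * j%:R + (psi - phase b)).
  apply: eq_bigr => j _; congr cos; rewrite /wave/=.
  have -> : al = nu + 2 * pi * be / Q%:R by rewrite -alnu addrC subrK.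
  by rewrite /t; field; rewrite gt_eqF.
have st : sin (t / 2) = - sin (pi * (k%:R - be) / Q%:R).
  by rewrite -sinN; congr sin; rewrite /t; field; rewrite gt_eqF.
have s0 : 0 < sin (pi * (k%:R - be) / Q%:R).
  apply: sin_gt0_pi; have p0 := pi_gt0 R.
  by rewrite divr_gt0 ?mulr_gt0//= ltr_pdivrMr// ltr_pM2l.
have st0 : sin (t / 2) != 0 by rewrite st oppr_eq0 gt_eqF.
have := @sum_cos_le t (psi - phase b) lo hi st0.
rewrite dE st normrN (gtr0_norm s0) -exprVn => h.
by rewrite -real_normK ?num_real// ler_pXn2r// nnegrE ?invr_ge0 ltW.
Qed.

(** A bin [k] outside the window lies at least [tau] above [be], and at least [tau] below [Q + be],
    the periodic copy of [be]. The factor 8 is 4 for each of the two phases; each sum of inverse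
    squares is at most [2 / tau] since [tau >= 2]. *)
Lemma dft_tail Q W nu al psi lo hi (be tau : R) :
  al - nu = 2 * pi * be / Q%:R -> 2 <= tau -> tau <= W%:R - be -> tau <= be ->
  (W <= Q)%N ->
  \sum_(W <= k < Q) (dft Q nu al psi lo hi (k, false) ^+ 2 +
                     dft Q nu al psi lo hi (k, true) ^+ 2) <= 32 * Q%:R ^+ 2 / tau.
Proof.
move=> alnu tau2 tauW taub WQ.
pose B k : R := ((k%:R - be) ^+ 2)^-1 + ((Q%:R + be - k%:R) ^+ 2)^-1.
have : \sum_(W <= k < Q) (dft Q nu al psi lo hi (k, false) ^+ 2 +
    dft Q nu al psi lo hi (k, true) ^+ 2) <= \sum_(W <= k < Q) 8 * Q%:R ^+ 2 * B k.
  rewrite big_nat [leRHS]big_nat; apply: ler_sum => k /andP[Wk kQ].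
  have Wk' : W%:R <= k%:R :> R by rewrite ler_nat.
  have kQ' : k%:R < Q%:R :> R by rewrite ltr_nat.
  have hk : 0 < k%:R - be < Q%:R by apply/andP; split; lra.
  have := @dft_le Q nu al psi lo hi k false be alnu hk.
  have := @dft_le Q nu al psi lo hi k true be alnu hk.
  by rewrite -/(B k); lra.
move=> /le_trans; apply; rewrite -mulr_sumr big_split/=.
have W1 : 1 < W%:R - be by lra.
have Q1 : 1 < Q%:R + be - Q%:R by lra.
have := sum_inv_sq W1 WQ; have := sum_inv_sq_rev Q1 WQ.
set S1 := \sum_(_ <= _ < _) _; set S2 := \sum_(_ <= _ < _) _ => h1 h2.
have h1' : S1 <= 2 / tau.
  apply: le_trans h1 _; rewrite -[leLHS]div1r ler_pdivrMr; last lra.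
  by rewrite mulrAC ler_pdivlMr; lra.
have h2' : S2 <= 2 / tau.
  apply: le_trans h2 _; rewrite -[leLHS]div1r ler_pdivrMr; last lra.
  by rewrite mulrAC ler_pdivlMr; lra.
have -> : 32 * Q%:R ^+ 2 / tau = 8 * Q%:R ^+ 2 * (2 / tau + 2 / tau).
  by field; lra.
by apply: ler_wpM2l; [rewrite mulr_ge0// sqr_ge0|lra].
Qed.

End Trigonometric.

(** * Step functions on a uniform grid *)

Section StepFunctions.
Variable R : realType.
Local Notation mu := (@lebesgue_measure R).
Local Notation cfun := (cfun R).
Variables (A w : R) (Q : nat).
Hypothesis w0 : 0 < w.

Definition cell (j : nat) : set R := `[A + j%:R * w, A + j.+1%:R * w[.

Lemma measurable_cell j : measurable (cell j).
Proof. exact: measurable_itv. Qed.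

Lemma mu_cell j : mu (cell j) = w%:E.
Proof.
rewrite /cell lebesgue_measure_itv/= lte_fin ltrD2l ltr_pM2r// ltr_nat ltnSn.
by rewrite -EFinB; congr (_%:E); rewrite -[j.+1%:R]natr1; ring.
Qed.

Lemma cell_uniq i j t : cell i t -> cell j t -> i = j.
Proof.
wlog ij : i j / (i < j)%N => [h ci cj|].
  by have [/h->//|/h h'|//] := ltngtP i j; rewrite h'.
rewrite /cell/= !in_itv/= => /andP[_ ti] /andP[jt _].
have := le_lt_trans jt ti; rewrite ltrD2l ltr_pM2r// ltr_nat ltnS leqNgt.
by rewrite ij.
Qed.

Definition comb (c : nat -> R) (t : R) : R := \sum_(0 <= j < Q) c j * \1_(cell j) t.

Lemma comb_cell c j t : (j < Q)%N -> cell j t -> comb c t = c j.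
Proof.
move=> jQ tj; rewrite /comb (bigD1_seq j) ?iota_uniq ?mem_index_iota//=.
rewrite indicE mem_set// mulr1 big1 ?addr0// => i ij.
rewrite indicE memNset ?mulr0// => ti.
by move: ij; rewrite (cell_uniq ti tj) eqxx.
Qed.

Lemma comb_out c t : (forall j, (j < Q)%N -> ~ cell j t) -> comb c t = 0.
Proof.
move=> h; rewrite /comb big_nat big1// => j /andP[_ jQ].
by rewrite indicE memNset ?mulr0//; exact: h.
Qed.

Lemma cellP t : (exists2 j, (j < Q)%N & cell j t) \/
  ((forall j, (j < Q)%N -> ~ cell j t) /\ (t < A \/ A + Q%:R * w <= t)).
Proof.
have [[j jQ tj]|nc] := pselect (exists2 j, (j < Q)%N & cell j t); first by left; exists j.
right; split; first by move=> j jQ tj; apply: nc; exists j.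
have [tA|At] := ltP t A; [by left|right].
rewrite leNgt; apply/negP => tQ; apply: nc.
have d0 : 0 <= (t - A) / w by rewrite divr_ge0 ?subr_ge0// ltW.
have /andP[h1 h2] := truncn_itv d0.
exists (Num.truncn ((t - A) / w)).
  by rewrite truncn_lt_nat// ltr_pdivrMr// ltrBlDl.
rewrite /cell/= in_itv/=; apply/andP; split.
  by rewrite -lerBrDl -ler_pdivlMr.
by rewrite -ltrBlDl -ltr_pdivrMr.
Qed.

Lemma comb_mul c d t : comb c t * comb d t = comb (fun j => c j * d j) t.
Proof.
have [[j jQ tj]|[nt _]] := cellP t; first by rewrite !(comb_cell _ jQ tj).
by rewrite !comb_out// mulr0.
Qed.

Lemma cell_integrable j : mu.-integrable setT (EFin \o (\1_(cell j) : R -> R)).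
Proof. exact: integrable_indic_itv. Qed.

Lemma comb_integrable c : mu.-integrable setT (EFin \o comb c).
Proof.
have -> : EFin \o comb c = (fun t => \sum_(0 <= j < Q) (c j)%:E * (\1_(cell j) t)%:E)%E.
  by apply/funext => t /=; rewrite /comb -sumEFin; apply: eq_bigr => j _; rewrite EFinM.
apply: integrable_sum => // j _; exact: (integrableZl measurableT _ (cell_integrable j)).
Qed.

Lemma Rintegral_comb c : \int[mu]_t comb c t = w * \sum_(0 <= j < Q) c j.
Proof.
have ii j : mu.-integrable setT (EFin \o (fun t => c j * \1_(cell j) t)).
  exact: (integrableZl measurableT _ (cell_integrable j)).
rewrite /comb; elim: (Q) => [|n ih].
  under eq_Rintegral do rewrite big_geq//.
  by rewrite Rintegral_cst// mul0r big_geq// mulr0.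
under eq_Rintegral do rewrite big_nat_recr//=.
rewrite RintegralD//; last first.
  rewrite (_ : EFin \o _ =
    (fun t => \sum_(0 <= j < n) (c j * \1_(cell j) t)%:E)%E); last first.
    by apply/funext => t /=; rewrite sumEFin.
  by apply: integrable_sum => // j _; exact: ii.
rewrite ih big_nat_recr//= mulrDr; congr (_ + _).
rewrite RintegralZl//; last exact: cell_integrable.
rewrite /Rintegral integral_indic//; last exact: measurable_cell.
by rewrite setIT [X in fine X]mu_cell/= mulrC.
Qed.

Definition step (x : nat -> cplx R) : cfun :=
  fun t => (comb (fun j => (x j).1) t, comb (fun j => (x j).2) t).

Lemma measurable_comb c : measurable_fun setT (comb c).
Proof. by apply/measurable_EFinP; have /integrableP[] := comb_integrable c. Qed.

Lemma comb_add c d t : comb c t + comb d t = comb (fun j => c j + d j) t.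
Proof. by rewrite /comb -big_split; apply: eq_bigr => j _ /=; rewrite mulrDl. Qed.

Lemma dot_step x y t : dot (step x) (step y) t =
  comb (fun j => (x j).1 * (y j).1 + (x j).2 * (y j).2) t.
Proof. by rewrite /dot/= !comb_mul comb_add. Qed.

Lemma ip_step x y : ip (step x) (step y) =
  w * \sum_(0 <= j < Q) ((x j).1 * (y j).1 + (x j).2 * (y j).2).
Proof. by rewrite -Rintegral_comb; apply: eq_Rintegral => t _; exact: dot_step. Qed.

Lemma L2_step x : L2 (step x).
Proof.
apply: L2P; first by split; exact: measurable_comb.
pose d j := (x j).1 * (x j).1 + (x j).2 * (x j).2.
have -> : normsq (step x) = (\int[mu]_t (comb d t)%:E)%E.
  by apply: eq_integral => t _; rewrite -dot_step /dot !expr2.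
have := integrable_fin_num measurableT (comb_integrable d).
by rewrite fin_numElt => /andP[].
Qed.

End StepFunctions.

(** * Sampled exponentials and modulated indicators *)

Section Atoms.
Variable R : realType.
Local Notation mu := (@lebesgue_measure R).
Local Notation cfun := (cfun R).

(** The exponential of frequency [nu + k / T], sampled at the left ends of the cells of [[A, A + T[]
    with its phase counted from [A]. The factor [1 / sqrt T] makes the norm 1, since there are [Q]
    cells of length [T / Q]. *)
Definition basis (A T nu : R) (Q : nat) (kp : nat * bool) : cfun :=
  step A (T / Q%:R) Q (fun j =>
    ((Num.sqrt T)^-1 * cos (wave Q (2 * pi * nu * (T / Q%:R)) kp j),
     (Num.sqrt T)^-1 * sin (wave Q (2 * pi * nu * (T / Q%:R)) kp j))).

Definition atom (p q psi : R) : cfun :=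
  fun t => (cos psi * \1_(`]p, q]) t, sin psi * \1_(`]p, q]) t).

Definition packet (b p q psi : R) : cfun :=
  fun t => (cos (2 * pi * b * t + psi) * \1_(`]p, q]) t,
            sin (2 * pi * b * t + psi) * \1_(`]p, q]) t).

Lemma gabor_atom p q psi a b :
  gabor (atom p q psi) (a, b) = packet b (p + a) (q + a) psi.
Proof.
apply/funext => t; rewrite /gabor /packet /cmul /=.
have -> : \1_(`]p, q]) (t - a) = \1_(`]p + a, q + a]) t :> R.
  by rewrite !indicE; congr (nat_of_bool _)%:R; apply/idP/idP;
    rewrite !inE/= !in_itv/= ltrBrDr lerBlDr.
by rewrite cosD sinD; congr pair; ring.
Qed.

Lemma meas2_packet b p q psi : meas2 (packet b p q psi).
Proof.
have m : measurable_fun [set: R] (fun x : R => 2 * pi * b * x + psi).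
  apply: measurable_funD; last exact: measurable_cst.
  by apply: measurable_funM => //; exact: measurable_cst.
have mi : measurable_fun setT (\1_(`]p, q]) : R -> R) by exact: measurable_indic.
split; apply: measurable_funM => //; apply: measurableT_comp m;
  apply: continuous_measurable_fun.
  exact: continuous_cos.
exact: continuous_sin.
Qed.

Section Sampling.
Variables (A T : R) (Q : nat).
Hypotheses (T0 : 0 < T) (Q0 : (0 < Q)%N).
Local Notation w := (T / Q%:R).

Let Q0' : 0 < Q%:R :> R. Proof. by rewrite ltr0n. Qed.
Let w0 : 0 < w. Proof. by rewrite divr_gt0. Qed.
Let sq2 : (Num.sqrt T)^-1 ^+ 2 = T^-1.
Proof. by rewrite exprVn sqr_sqrtr// ltW. Qed.

Lemma L2_basis nu kp : L2 (basis A T nu Q kp).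
Proof. exact: L2_step. Qed.

Lemma basis_ortho nu kp lp : (kp.1 < Q)%N -> (lp.1 < Q)%N ->
  ip (basis A T nu Q kp) (basis A T nu Q lp) = (kp == lp)%:R.
Proof.
move: kp lp => [k b] [l c]/= kQ lQ; rewrite ip_step//=.
set om := 2 * pi * nu * w; rewrite (eq_bigr (fun j =>
  T^-1 * cos (wave Q om (k, b) j - wave Q om (l, c) j))); last first.
  by move=> j _; rewrite cosB -sq2; ring.
rewrite -mulr_sumr wave_ortho// mulrA mulrA -xpair_eqE.
by rewrite (_ : w / T * Q%:R = 1) ?mul1r//; field; rewrite !gt_eqF.
Qed.

Definition sample (f : cfun) : cfun := step A w Q (fun j => f (A + j%:R * w)).

Lemma sum_range (F : nat -> R) lo hi : (hi <= Q)%N ->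
  \sum_(0 <= j < Q) (if (lo <= j < hi)%N then F j else 0) = \sum_(lo <= j < hi) F j.
Proof.
move=> hiQ; rewrite [RHS](big_nat_widenl _ 0)// [RHS](big_nat_widen _ _ Q)// -big_mkcond/=.
by apply: eq_bigl => j.
Qed.

Variables (b p q psi : R).
Hypotheses (Ap : A <= p) (pq : p <= q) (qT : q < A + T).

(** The sample point [A + j * w] lies in []p, q]] when [(p - A) / w < j <= (q - A) / w]. With the
    left end excluded and the right one included, both bounds are a truncation plus one. *)
Let lo := (Num.truncn ((p - A) / w)).+1.
Let hi := (Num.truncn ((q - A) / w)).+1.

Let lohiQ : (lo <= hi <= Q)%N.
Proof.
have qA : 0 <= (q - A) / w by rewrite divr_ge0 ?(ltW w0)// subr_ge0 (le_trans Ap).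
apply/andP; split.
  by rewrite ltnS le_truncn// ler_pM2r ?invr_gt0// lerD2r.
by rewrite /hi truncn_lt_nat// ltr_pdivrMr// mulrCA divff ?gt_eqF// mulr1 ltrBlDl.
Qed.

Let ind_sample j : \1_(`]p, q]) (A + j%:R * w) = (if (lo <= j < hi)%N then 1 else 0) :> R.
Proof.
have pA : 0 <= (p - A) / w by rewrite divr_ge0 ?(ltW w0)// subr_ge0.
have qA : 0 <= (q - A) / w by rewrite divr_ge0 ?(ltW w0)// subr_ge0 (le_trans Ap).
rewrite indicE; have -> : (A + j%:R * w \in `]p, q]%classic) = (lo <= j < hi)%N.
  apply/idP/idP; rewrite inE/= in_itv/= /lo /hi ltnS truncn_ge_nat// truncn_lt_nat//;
  by rewrite ltr_pdivrMr// ler_pdivlMr// ltrBlDl lerBrDl.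
by case: ifP.
Qed.

Local Notation f := (packet b p q psi).
Local Notation al := (2 * pi * b * w).
Local Notation psi' := (2 * pi * b * A + psi).

Lemma ip_sample_basis nu kp :
  ip (sample f) (basis A T nu Q kp) =
  w * (Num.sqrt T)^-1 * dft Q (2 * pi * nu * w) al psi' lo hi kp.
Proof.
rewrite ip_step// -(mulrA w); congr (_ * _); rewrite /dft -(@sum_range _ lo hi); last first.
  by case/andP: lohiQ.
rewrite mulr_sumr; apply: eq_bigr => j _; rewrite /= ind_sample.
case: ifP => _; last by rewrite !mulr0 !mul0r addr0.
rewrite cosB !mulr1.
have -> : 2 * pi * b * (A + j%:R * w) + psi = al * j%:R + psi' by ring.
ring.
Qed.

Lemma ip_sample : ip (sample f) (sample f) = w * (hi - lo)%:R.
Proof.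
rewrite ip_step//; congr (_ * _).
rewrite (eq_bigr (fun j => if (lo <= j < hi)%N then 1 else 0)).
  by rewrite sum_range ?sumr_const_nat//; case/andP: lohiQ.
move=> j _; rewrite /= ind_sample; case: ifP => _; last by rewrite !mulr0 addr0.
by rewrite !mulr1 -!expr2 cos2Dsin2.
Qed.

Lemma bessel_eq (I : finType) (s : cfun) (e : I -> cfun) : L2 s -> (forall i, L2 (e i)) ->
  (forall i j, ip (e i) (e j) = (i == j)%:R) ->
  normsq (csub s (lc (fun i => ip s (e i)) e)) =
  (ip s s - \sum_i ip s (e i) ^+ 2)%:E.
Proof.
move=> s2 e2 on; rewrite normsq_csub//; last exact: L2_lc.
rewrite ip_sym ip_lc// ip_lc2//.
have -> : \sum_i ip s (e i) * \sum_j ip s (e j) * ip (e i) (e j) = \sum_i ip s (e i) ^+ 2.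
  apply: eq_bigr => i _; rewrite (bigD1 i)//= on eqxx mulr1 big1 ?addr0 ?expr2//.
  by move=> j /negPf ji; rewrite on eq_sym ji mulr0.
have -> : \sum_i ip s (e i) * ip (e i) s = \sum_i ip s (e i) ^+ 2.
  by apply: eq_bigr => i _; rewrite (ip_sym (e i)) expr2.
by congr (_%:E); ring.
Qed.

(* By Parseval the squared distance is the sum of the squares of the coefficients
   outside the window. *)
Lemma sample_approx nu W tau : (W <= Q)%N -> 2 <= tau ->
  tau <= W%:R - T * (b - nu) -> tau <= T * (b - nu) ->
  exists c : 'I_W * bool -> R,
    (normsq (csub (sample f) (lc c (fun kp => basis A T nu Q (val kp.1, kp.2)))) <=
     (32 * T / tau)%:E)%E.
Proof.
move=> WQ tau2 tauW taub.
pose E (kp : 'I_W * bool) := basis A T nu Q (val kp.1, kp.2).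
exists (fun kp => ip (sample f) (E kp)); rewrite -/E bessel_eq; last 3 first.
- exact: L2_step.
- by move=> kp; exact: L2_basis.
- move=> [k c] [l d]; rewrite basis_ortho ?(leq_trans (ltn_ord _))//=.
rewrite lee_fin ip_sample.
pose S k := dft Q (2 * pi * nu * w) al psi' lo hi (k, false) ^+ 2 +
            dft Q (2 * pi * nu * w) al psi' lo hi (k, true) ^+ 2.
have -> : \sum_(i : 'I_W * bool) ip (sample f) (E i) ^+ 2 =
    w ^+ 2 / T * \sum_(0 <= k < W) S k.
  rewrite -(pair_bigA _ (fun (k : 'I_W) c => ip (sample f) (basis A T nu Q (val k, c)) ^+ 2))/=.
  rewrite mulr_sumr big_mkord; apply: eq_bigr => k _.
  by rewrite big_bool/= !ip_sample_basis /S -sq2; ring.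
have -> : w * (hi - lo)%:R = w ^+ 2 / T * \sum_(0 <= k < Q) S k.
  by rewrite dft_parseval//; field; rewrite !gt_eqF.
rewrite (@big_cat_nat _ _ _ W 0 Q)//= mulrDr addrC addKr.
(* [T * (b - nu)] is the position of the frequency [b] in the window, in units of the spacing
   [1 / T]. *)
have alnu : al - 2 * pi * nu * w = 2 * pi * (T * (b - nu)) / Q%:R.
  by field; rewrite gt_eqF.
have := @dft_tail _ Q W (2 * pi * nu * w) al psi' lo hi _ tau alnu tau2 tauW taub WQ.
rewrite -/(S _) => h; have tau0 : 0 < tau by lra.
have -> : 32 * T / tau = w ^+ 2 / T * (32 * Q%:R ^+ 2 / tau).
  by field; rewrite !gt_eqF.
by rewrite ler_wpM2l// divr_ge0 ?sqr_ge0// ltW.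
Qed.

End Sampling.
End Atoms.

(** * Error of sampling a modulated indicator *)

Section SampleDistance.
Variable R : realType.
Local Notation mu := (@lebesgue_measure R).
Local Notation cfun := (cfun R).

Lemma sqr_le_norm (a b : R) : `|a| <= b -> a ^+ 2 <= b ^+ 2.
Proof.
move=> ab; have b0 : 0 <= b by apply: le_trans ab.
by rewrite -[leLHS]real_normK ?num_real// ler_pXn2r ?nnegrE.
Qed.

Lemma sqn_phase (a b : R) : (cos a - cos b) ^+ 2 + (sin a - sin b) ^+ 2 <= 2 * (a - b) ^+ 2.
Proof.
have := sqr_le_norm (cos_lipschitz a b); have := sqr_le_norm (sin_lipschitz a b).
by rewrite real_normK ?num_real//; lra.
Qed.

Lemma indic_ocE (a c x : R) : \1_(`]a, c]) x = (a < x <= c)%R%:R :> R.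
Proof.
by rewrite indicE; congr (nat_of_bool _)%:R; apply/idP/idP; rewrite inE/= in_itv.
Qed.

Lemma indic_coE (a c x : R) : \1_(`[a, c[) x = (a <= x < c)%R%:R :> R.
Proof.
by rewrite indicE; congr (nat_of_bool _)%:R; apply/idP/idP; rewrite inE/= in_itv.
Qed.

Lemma integral_indic_oc (a b : R) : a <= b ->
  (\int[mu]_t (\1_(`]a, b]) t)%:E = (b - a)%:E)%E.
Proof.
move=> ab; rewrite integral_indic//= setIT lebesgue_measure_itv/= lte_fin.
by have [_|] := ltP a b; [rewrite EFinB|move=> ba; rewrite (@le_anti _ _ a b) ?ab// subrr].
Qed.

Variables (A T : R) (Q : nat) (b p q psi : R).
Hypotheses (T0 : 0 < T) (Q0 : (0 < Q)%N).
Local Notation w := (T / Q%:R).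
Hypotheses (Ap : A <= p) (pq : p <= q) (qT : q < A + T).
Local Notation f := (packet b p q psi).

Let Q0' : 0 < Q%:R :> R. Proof. by rewrite ltr0n. Qed.
Let w0 : 0 < w. Proof. by rewrite divr_gt0. Qed.
Let wQ : Q%:R * w = T. Proof. by rewrite mulrCA divff ?mulr1// gt_eqF. Qed.

(** Within a cell the phase moves by at most [2 * pi * b * w] in absolute value. The indicator
    differs from its sample only just after a jump, within [w] to the right of [p] or [q]. The first
    interval starts at [A - w] so that the point [A], which belongs to the first cell, is
    covered. *)
Lemma sample_sqn t : sqn (csub f (sample A T Q f)) t <=
  2 * (2 * pi * b * w) ^+ 2 * \1_(`]A - w, A + T]) t +
  (\1_(`]p, p + w]) t + \1_(`]q, q + w]) t).
Proof.
have hAp := Ap; have hpq := pq; have hqT := qT; have hT0 := T0; have hw0 := w0.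
set K := 2 * _; have K0 : 0 <= K by rewrite mulr_ge0// sqr_ge0.
have i0 (B : set R) : 0 <= \1_B t :> R by [].
have rhs0 : 0 <= K * \1_(`]A - w, A + T]) t + (\1_(`]p, p + w]) t + \1_(`]q, q + w]) t).
  by rewrite !addr_ge0// mulr_ge0.
rewrite /sqn /csub /sample/=.
have [[j jQ tj]|[nt tA]] := cellP A Q w0 t; last first.
  rewrite !comb_out// !subr0 indic_ocE (_ : (p < t <= q) = false).
    by rewrite !mulr0 expr0n/= addr0.
  apply/negP => /andP[pt tq]; case: tA => tA.
    by have := lt_trans (le_lt_trans Ap pt) tA; rewrite ltxx.
  by rewrite wQ in tA; have := lt_le_trans (le_lt_trans tq qT) tA; rewrite ltxx.
rewrite !(comb_cell w0 _ jQ tj)/=.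
move: tj; rewrite /cell/= in_itv/= => /andP[tj1 tj2].
set tj := A + j%:R * w in tj1 *.
have tj3 : t < tj + w by move: tj2; rewrite -[j.+1%:R]natr1 mulrDl mul1r addrA.
have tA : A <= t by apply: le_trans tj1; rewrite lerDl mulr_ge0// ltW.
have tT : t < A + T.
  have : j.+1%:R * w <= Q%:R * w by rewrite ler_wpM2r ?(ltW w0)// ler_nat.
  by rewrite wQ => jT; apply: lt_le_trans tj2 _; rewrite lerD2l.
have phase_le : (cos (2 * pi * b * t + psi) - cos (2 * pi * b * tj + psi)) ^+ 2 +
    (sin (2 * pi * b * t + psi) - sin (2 * pi * b * tj + psi)) ^+ 2 <= K.
  apply: le_trans (sqn_phase _ _) _; rewrite /K ler_pM2l//.
  have -> : 2 * pi * b * t + psi - (2 * pi * b * tj + psi) = 2 * pi * b * (t - tj) by ring.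
  rewrite !(exprMn _ (2 * pi * b)) ler_wpM2l ?sqr_ge0//.
  have d0 : 0 <= t - tj by lra.
  have dw : t - tj <= w by lra.
  by rewrite ler_pXn2r// nnegrE ltW.
have cs1 := cos2Dsin2 (2 * pi * b * t + psi).
have cs2 := cos2Dsin2 (2 * pi * b * tj + psi).
move: phase_le cs1 cs2; set c1 := cos _; set s1 := sin _; set c2 := cos _; set s2 := sin _.
move=> phase_le cs1 cs2; rewrite !indic_ocE.
have -> : (A - w < t <= A + T) by apply/andP; split; lra.
have [h1|h1] := boolP (p < t <= q); have [h2|h2] := boolP (p < tj <= q).
- rewrite !mulr1; apply: le_trans phase_le _.
  by rewrite lerDl addr_ge0.
- have -> : (p < t <= p + w).
    have /andP[pt tq] := h1; rewrite pt/=.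
    have : ~~ (p < tj) by apply: contra h2 => ->/=; lra.
    rewrite -leNgt => tjp; lra.
  rewrite !mulr0 !subr0 !mulr1 cs1 /=; have := ler0n R (q < t <= q + w)%R; lra.
- have -> : (q < t <= q + w).
    have /andP[pt tq] := h2.
    have : ~~ (t <= q) by apply: contra h1 => ->; rewrite andbT; lra.
    rewrite -ltNge => ->/=; lra.
  rewrite !mulr0 !sub0r !sqrrN !mulr1 cs2 /=; have := ler0n R (p < t <= p + w)%R; lra.
- rewrite !mulr0 !subr0 expr0n/= addr0 !mulr1.
  by rewrite !addr_ge0.
Qed.

Lemma meas2_sample : meas2 (sample A T Q f).
Proof. exact: L2_meas2 (L2_step _ _ _ _). Qed.

Lemma sample_dist : (normsq (csub f (sample A T Q f)) <=
  (2 * (2 * pi * b * w) ^+ 2 * (T + w) + (w + w))%:E)%E.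
Proof.
have hAp := Ap; have hpq := pq; have hqT := qT; have hT0 := T0; have hw0 := w0.
pose K := 2 * (2 * pi * b * w) ^+ 2; have K0 : 0 <= K by rewrite mulr_ge0// sqr_ge0.
have mi a c : measurable_fun [set: R] (fun t => (\1_(`]a, c]) t : R)%:E).
  by apply/measurable_EFinP; exact: measurable_indic.
have mKi a c : measurable_fun [set: R] (fun t => (K%:E * (\1_(`]a, c]) t)%:E)%E).
  by apply: emeasurable_funM => //; exact: measurable_cst.
have mf : meas2 (csub f (sample A T Q f)).
  by apply: meas2_sub; [exact: meas2_packet|exact: meas2_sample].
apply: (@le_trans _ _ (\int[mu]_t (K%:E * (\1_(`](A - w)%R, (A + T)%R]) t)%:E +
   ((\1_(`]p, (p + w)%R]) t)%:E + (\1_(`]q, (q + w)%R]) t)%:E)))%E).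
  rewrite /normsq; apply: ge0_le_integral => //.
  - by move=> t _; rewrite lee_fin; exact: sqn_ge0.
  - exact: meas2_sqn.
  - by apply: emeasurable_funD; [exact: mKi|apply: emeasurable_funD; exact: mi].
  - by move=> t _; rewrite -EFinM -!EFinD lee_fin; exact: sample_sqn.
have i0 a c t : (0 <= (\1_(`]a, c]) t : R)%:E)%E by rewrite lee_fin.
have Ki0 a c t : (0 <= K%:E * (\1_(`]a, c]) t : R)%:E)%E by rewrite mule_ge0.
rewrite ge0_integralD//; [|exact: mKi|by move=> t _; exact: adde_ge0|by apply: emeasurable_funD; exact: mi].
rewrite ge0_integralD//; [|exact: mi..].
have intK a c : a <= c -> (\int[mu]_t (K%:E * (\1_(`]a, c]) t : R)%:E) = (K * (c - a))%:E)%E.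
  by move=> ac; rewrite [RHS]EFinM -(integral_indic_oc ac); apply: ge0_integralZl_EFin => //; exact: mi.
rewrite intK; last lra.
rewrite integral_indic_oc; last lra.
rewrite integral_indic_oc; last lra.
rewrite -!EFinD lee_fin -/K; lra.
Qed.

End SampleDistance.

(** * The homogeneous approximation property *)

Section Homogeneous.
Variable R : realType.
Local Notation mu := (@lebesgue_measure R).
Local Notation cfun := (cfun R).
Implicit Types f h : cfun.

(* More than [T ^+ 2] frequencies with spacing [T^-1], for [T = 2 * (r + rho)],
   so that they cover an interval of length [T]. *)
Definition window (r rho : R) : nat := (Num.truncn ((2 * (r + rho)) ^+ 2)).+1.

Definition window_basis (r rho a0 b0 : R) (Q : nat)
    (kp : 'I_(window r rho) * bool) : cfun :=
  basis (a0 - r - rho) (2 * (r + rho)) (b0 - r - rho) Q (val kp.1, kp.2).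

Arguments window_basis : clear implicits.

(* Homogeneous approximation property: the margin [rho] depends neither on [r] nor
   on the center of the square. Only the mesh [T / Q] of the grid may do so. *)
Definition HAP h := forall eps : R, 0 < eps -> exists rho0, forall rho, rho0 <= rho ->
  forall r a0 b0 a b, 0 <= r -> `|a - a0| <= r -> `|b - b0| <= r ->
  exists M : nat, forall Q, (M <= Q)%N -> exists c,
  (normsq (csub (gabor h (a, b)) (lc c (window_basis r rho a0 b0 Q))) <= eps%:E)%E.

Lemma meas2_basis A T nu Q kp : meas2 (@basis R A T nu Q kp).
Proof. by split; exact: measurable_comb. Qed.

Lemma meas2_res h z r rho a0 b0 Q c : meas2 h ->
  meas2 (csub (gabor h z) (lc c (window_basis r rho a0 b0 Q))).
Proof.
move=> mh; apply: meas2_sub; first exact: meas2_gabor.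
by apply: meas2_lc => kp; exact: meas2_basis.
Qed.

Lemma HAP_add f h : meas2 f -> meas2 h -> HAP f -> HAP h -> HAP (cadf f h).
Proof.
move=> mf mh Hf Hh eps eps0; have e4 : 0 < eps / 4 by rewrite divr_gt0.
have [r1 H1] := Hf _ e4; have [r2 H2] := Hh _ e4.
exists (Num.max r1 r2) => rho; rewrite ge_max => /andP[rr1 rr2] r a0 b0 a b r0 ha hb.
have [M1 {}H1] := H1 _ rr1 _ _ _ _ _ r0 ha hb.
have [M2 {}H2] := H2 _ rr2 _ _ _ _ _ r0 ha hb.
exists (maxn M1 M2) => Q; rewrite geq_max => /andP[Q1 Q2].
have [c1 {}H1] := H1 _ Q1; have [c2 {}H2] := H2 _ Q2.
exists (fun k => c1 k + c2 k).
set E := window_basis _ _ _ _ _ in H1 H2 *.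
have -> : csub (gabor (cadf f h) (a, b)) (lc (fun k => c1 k + c2 k) E) =
   cadf (csub (gabor f (a, b)) (lc c1 E)) (csub (gabor h (a, b)) (lc c2 E)).
  apply/funext => t; rewrite /csub /cadf /gabor /cmul /lc /=.
  under eq_bigr do rewrite mulrDl.
  under [X in (_, _ - X)]eq_bigr do rewrite mulrDl.
  by rewrite !big_split/=; congr pair; ring.
apply: le_trans (normsq_add_le _ _) _; [exact: meas2_res..|].
have -> : eps%:E = (2%:E * (eps / 4)%:E + 2%:E * (eps / 4)%:E)%E.
  by rewrite -!EFinM -EFinD; congr (_%:E); field.
by apply: leeD; apply: lee_wpmul2l.
Qed.

Lemma HAP_scale x h : meas2 h -> HAP h -> HAP (cscale x h).
Proof.
(* Dividing [eps] by [x ^+ 2 + 1] rather than [x ^+ 2] includes the case [x = 0]. *)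
move=> mh Hh eps eps0; have x0 : 0 < x ^+ 2 + 1 by rewrite ltr_wpDl// sqr_ge0.
have [r1 H1] := Hh _ (divr_gt0 eps0 x0).
exists r1 => rho rr r a0 b0 a b r0 ha hb.
have [M {}H1] := H1 _ rr _ _ _ _ _ r0 ha hb.
exists M => Q QM; have [c {}H1] := H1 _ QM; exists (fun k => x * c k).
set E := window_basis _ _ _ _ _ in H1 *.
have -> : csub (gabor (cscale x h) (a, b)) (lc (fun k => x * c k) E) =
   cscale x (csub (gabor h (a, b)) (lc c E)).
  apply/funext => t; rewrite /csub /cscale /gabor /cmul /lc /=.
  under eq_bigr do rewrite -mulrA.
  under [X in (_, _ - X)]eq_bigr do rewrite -mulrA.
  by rewrite -!mulr_sumr; congr pair; ring.
rewrite normsq_scale; last exact: meas2_res.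
apply: (@le_trans _ _ ((x ^+ 2)%:E * (eps / (x ^+ 2 + 1))%:E)%E).
  by apply: lee_wpmul2l; rewrite ?lee_fin ?sqr_ge0.
rewrite -EFinM lee_fin mulrCA ger_pMr// ler_pdivrMr//; lra.
Qed.

(** Time-frequency shifts are isometries, so the error of replacing [h] by [h'] is the same at every
    [(a, b)], and the margin of [h'] serves for [h]. *)
Lemma HAP_lim h : meas2 h -> (forall eps : R, 0 < eps -> exists h',
  [/\ meas2 h', HAP h' & (normsq (csub h h') <= eps%:E)%E]) -> HAP h.
Proof.
move=> mh lim eps eps0; have e4 : 0 < eps / 4 by rewrite divr_gt0.
have [h' [mh' Hh' hh']] := lim _ e4; have [r1 H1] := Hh' _ e4.
exists r1 => rho rr r a0 b0 a b r0 ha hb.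
have [M {}H1] := H1 _ rr _ _ _ _ _ r0 ha hb.
exists M => Q QM; have [c {}H1] := H1 _ QM; exists c.
set E := window_basis _ _ _ _ _ in H1 *.
have -> : csub (gabor h (a, b)) (lc c E) =
    cadf (gabor (csub h h') (a, b)) (csub (gabor h' (a, b)) (lc c E)).
  by apply/funext => t; rewrite /csub /cadf /gabor /cmul /lc /=; congr pair; ring.
have md : meas2 (csub h h') by exact: meas2_sub.
apply: le_trans (normsq_add_le _ _) _; [exact: meas2_gabor|exact: meas2_res|].
rewrite normsq_gabor//.
have -> : eps%:E = (2%:E * (eps / 4)%:E + 2%:E * (eps / 4)%:E)%E.
  by rewrite -!EFinM -EFinD; congr (_%:E); field.
by apply: leeD; apply: lee_wpmul2l.
Qed.

Lemma meas2_atom p q psi : meas2 (@atom R p q psi).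
Proof.
by split; apply: measurable_funM; [exact: measurable_cst|exact: measurable_indic|
  exact: measurable_cst|exact: measurable_indic].
Qed.

Lemma HAP_atom p q psi : p <= q -> HAP (@atom R p q psi).
Proof.
(* [1 + |p| + |q|] keeps the shifted interval inside the time window; [128 / eps] brings the
   frequency tail [32 / rho] below [eps / 4]. *)
move=> pq eps eps0; exists (1 + `|p| + `|q| + 128 / eps) => rho rhoge r a0 b0 a b r0 ha hb.
have p0 := normr_ge0 p; have q0 := normr_ge0 q.
have e0 : 0 < 128 / eps by rewrite divr_gt0.
have rho1 : 1 <= rho by lra.
have np := ler_norm (- p); rewrite normrN in np.
have nq := ler_norm q.
set T := 2 * (r + rho); have T0 : 0 < T by rewrite /T; lra.
set K := 2 * (2 * pi * b) ^+ 2; have K0 : 0 <= K by rewrite mulr_ge0// sqr_ge0.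
(* Chosen so that [Q >= B] gives [w * (2 * K * T ^+ 2 + 2) <= eps / 4] for the mesh [w = T / Q]. It
   depends on [b] through [K], which is why the mesh cannot be uniform. *)
set B := 4 * T * (2 * K * T ^+ 2 + 2) / eps.
exists (window r rho + (Num.truncn B).+1)%N => Q QM.
have WQ : (window r rho <= Q)%N by apply: leq_trans QM; rewrite leq_addr.
have Q0 : (0 < Q)%N by apply: leq_trans WQ.
have Q0' : 0 < Q%:R :> R by rewrite ltr0n.
have BQ : B <= Q%:R.
  apply: (@le_trans _ _ (Num.truncn B).+1%:R); first by apply/ltW/truncnS_gt.
  by rewrite ler_nat; apply: leq_trans QM; rewrite leq_addl.
have [/andP[ha1 ha2] /andP[hb1 hb2]] : (- r <= a - a0 <= r) /\ (- r <= b - b0 <= r).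
  by rewrite -!ler_norml.
set A := a0 - r - rho; set nu := b0 - r - rho.
have Ap : A <= p + a by rewrite /A; lra.
have pq' : p + a <= q + a by lra.
have qT : q + a < A + T by rewrite /A /T; lra.
(* The gap [tau] is [T * rho]: [b - nu] lies between [rho] and [2 * r + rho], a distance at least
   [rho] from both ends of a window of length [T]. *)
have tau2 : 2 <= T * rho by rewrite /T; nra.
have tauW : T * rho <= (window r rho)%:R - T * (b - nu).
  have : T ^+ 2 < (window r rho)%:R by exact: truncnS_gt.
  have : T * (rho + (b - nu)) <= T * T by rewrite ler_pM2l// /T /nu; lra.
  rewrite expr2; lra.
have taub : T * rho <= T * (b - nu) by rewrite ler_pM2l// /nu; lra.
have [c hc] := @sample_approx _ A T Q T0 Q0 b (p + a) (q + a) psi Ap pq' qT nu _ _ WQ tau2 tauW taub.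
exists c; rewrite gabor_atom -/T -/A -/nu.
set f := packet b (p + a) (q + a) psi in hc *; set S := sample A T Q f in hc *.
have := @sample_dist _ A T Q b _ _ psi T0 Q0 Ap pq' qT; rewrite -/f -/S => hs.
have mf : meas2 f by exact: meas2_packet.
have mS : meas2 S by exact: meas2_sample.
pose L := lc c (window_basis r rho a0 b0 Q).
have {}hc : (normsq (csub S L) <= (32 * T / (T * rho))%:E)%E by exact: hc.
have mL : meas2 L by apply: meas2_lc => k; exact: meas2_basis.
rewrite -/L.
have -> : csub f L = cadf (csub f S) (csub S L).
  by apply/funext => t; rewrite /csub /cadf/=; congr pair; ring.
apply: le_trans (normsq_add_le _ _) _; [exact: meas2_sub..|].
have -> : eps%:E = (2%:E * (eps / 4)%:E + 2%:E * (eps / 4)%:E)%E.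
  by rewrite -!EFinM -EFinD; congr (_%:E); field.
apply: leeD; apply: lee_wpmul2l => //.
- apply: le_trans hs _; rewrite lee_fin.
  set w := T / Q%:R; have w0 : 0 < w by rewrite divr_gt0.
  have wT : w <= T by rewrite ler_pdivrMr// ler_peMr ?(ltW T0)// ler1n.
  have : w * (2 * K * T ^+ 2 + 2) <= eps / 4.
    have -> : w * (2 * K * T ^+ 2 + 2) = (B * eps / 4) / Q%:R.
      by rewrite /w /B; field; rewrite !gt_eqF.
    rewrite ler_pdivrMr//; have := ler_wpM2r (ltW eps0) BQ; lra.
  apply: le_trans; rewrite -/K.
  have -> : 2 * (2 * pi * b * w) ^+ 2 * (T + w) + (w + w) = w * (K * (w * (T + w)) + 2).
    by rewrite /K; ring.
  rewrite ler_pM2l// lerD2r.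
  have : w * (T + w) <= T * (2 * T) by apply: ler_pM; lra.
  move=> /(ler_wpM2l K0); rewrite expr2; lra.
- apply: le_trans hc _; rewrite lee_fin.
  have -> : 32 * T / (T * rho) = 32 / rho by field; rewrite !gt_eqF//; lra.
  have rho0 : 0 < rho by lra.
  rewrite ler_pdivrMr//.
  have : 128 / eps * eps <= rho * eps by rewrite ler_pM2r//; lra.
  rewrite divfK ?gt_eqF//; lra.
Qed.

End Homogeneous.

Arguments window_basis {R} r rho a0 b0 Q kp.

(** * Density of step functions in L^2, as an induction principle *)

Section Density.
Variable R : realType.
Local Notation mu := (@lebesgue_measure R).
Implicit Types u v : R -> R.

Definition dsq u v : \bar R := (\int[mu]_t ((u t - v t) ^+ 2)%:E)%E.

Lemma cvge0_small (x : nat -> \bar R) (eps : R) : (x n @[n --> \oo] --> 0)%E ->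
  0 < eps -> exists n, (x n <= eps%:E)%E.
Proof.
move=> /fine_cvgP[fin cv] eps0.
have [n _ /(_ n (leqnn n)) [fn ln]] := filterI fin (cvgr_lt _ cv _ eps0).
by exists n; rewrite -(fineK fn) lee_fin ltW.
Qed.

Lemma dominated_dsq u (v : nat -> R -> R) (G : R -> R) (eps : R) :
  measurable_fun setT u -> (forall n, measurable_fun setT (v n)) ->
  mu.-integrable setT (EFin \o G) -> (forall n t, (u t - v n t) ^+ 2 <= G t) ->
  (forall t, v n t @[n --> \oo] --> u t) -> 0 < eps ->
  exists n, (dsq u (v n) <= eps%:E)%E.
Proof.
move=> mu_ mv iG vG vu eps0; apply: cvge0_small eps0.
pose f_ n t : \bar R := ((u t - v n t) ^+ 2)%:E.
have [] := @dominated_convergence _ _ R mu setT measurableT f_ (cst 0%E) (EFin \o G).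
- move=> n; apply/measurable_EFinP; apply: measurable_funX.
  exact: (measurable_funB mu_ (mv n)).
- exact: measurable_cst.
- apply: aeW => t _ /=; apply: cvg_EFin; first exact: nearW.
  rewrite (_ : fine \o _ = fun n => (u t - v n t) ^+ 2)//.
  rewrite [X in _ --> X](_ : _ = (u t - u t) * (u t - u t)); last by rewrite subrr mulr0.
  have h : u t - v n t @[n --> \oo] --> u t - u t by apply: cvgB => //; exact: cvg_cst.
  exact: (cvgM h h).
- exact: iG.
- apply: aeW => t n _ /=; rewrite lee_fin ger0_norm ?sqr_ge0//; exact: vG.
- by move=> _ _; rewrite integral_cst// mul0e.
Qed.

Lemma clip_dist (M x y : R) : `|x| <= M ->
  `|x - Num.max (- M) (Num.min M y)| <= `|x - y|.
Proof.
rewrite ler_norml => /andP[x1 x2]; have [yM|My] := leP y M.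
  have [My|yM'] := leP (- M) y; first by [].

  by rewrite ger0_norm; [have := ler_norm (x - y)|]; lra.
rewrite max_r; last lra.
rewrite distrC ger0_norm; last lra.
by rewrite distrC; have := ler_norm (y - x); lra.
Qed.

Section Induction.
Variable P : (R -> R) -> Prop.
Hypothesis Padd : forall u v, measurable_fun setT u -> measurable_fun setT v ->
  P u -> P v -> P (u \+ v).
Hypothesis Pscale : forall a u, measurable_fun setT u -> P u -> P (fun t => a * u t).
Hypothesis Patom : forall p q, p <= q -> P \1_(`[p, q[).
Hypothesis Plim : forall u, measurable_fun setT u ->
  (forall eps : R, 0 < eps -> exists v,
     [/\ measurable_fun setT v, P v & (dsq u v <= eps%:E)%E]) -> P u.

Lemma ind_comb A w Q c : 0 < w -> P (@comb R A w Q c).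
Proof.
move=> w0; elim: Q => [|Q ih].
  have -> : comb A w 0 c = (fun t => 0 * \1_(`[0, 0[) t).
    by apply/funext => t; rewrite /comb big_geq// mul0r.
  by apply: Pscale; [exact: measurable_indic|exact: Patom].
have -> : comb A w Q.+1 c = comb A w Q c \+ (fun t => c Q * \1_(cell A w Q) t).
  by apply/funext => t; rewrite /comb big_nat_recr.
apply: Padd => //; first exact: measurable_comb.
  by apply: measurable_funM; [exact: measurable_cst|apply: measurable_indic; exact: measurable_cell].
apply: Pscale; first by apply: measurable_indic; exact: measurable_cell.
by apply: Patom; rewrite lerD2l ler_pM2r// ler_nat.
Qed.

Lemma indic_co_out (M t : R) : ~ (- M <= t < M) -> \1_(`[- M, M[) t = 0 :> R.
Proof. by move=> /negP/negPf h; rewrite indic_coE h. Qed.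

Lemma indic_co_in (M t : R) : - M <= t < M -> \1_(`[- M, M[) t = 1 :> R.
Proof. by move=> h; rewrite indic_coE h. Qed.

Lemma indic_scale_integrable (a M : R) :
  mu.-integrable setT (EFin \o (fun t => a * \1_(`[- M, M[) t)).
Proof. exact: (integrableZl measurableT _ (integrable_indic_itv _ _ _ _)). Qed.

(** Sampling [g] on ever finer grids of [[- M, M[] converges pointwise by continuity, and the
    squared error is dominated by [(2 * B) ^+ 2] on that interval. *)
Lemma ind_continuous (g : R -> R) (B M : R) : continuous g -> (forall t, `|g t| <= B) ->
  0 < M -> P (fun t => g t * \1_(`[- M, M[) t).
Proof.
move=> cg gB M0.
have B0 : 0 <= B by apply: le_trans (gB 0).
have mg : measurable_fun setT (fun t => g t * \1_(`[- M, M[) t).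
  by apply: measurable_funM; [exact: continuous_measurable_fun|exact: measurable_indic].
apply: Plim => // eps eps0.
pose w n : R := 2 * M / n.+1%:R.
have w0 n : 0 < w n by rewrite divr_gt0// mulr_gt0.
have wE n : n.+1%:R * w n = 2 * M by rewrite mulrCA divff ?mulr1.
pose v n := comb (- M) (w n) n.+1 (fun j => g (- M + j%:R * w n)).
have vP t n : - M <= t < M -> exists2 s, v n t = g s & `|t - s| <= w n.
  move=> /andP[t1 t2]; have [[j jn tj]|[_]] := cellP (- M) n.+1 (w0 n) t.
    exists (- M + j%:R * w n); first exact: (comb_cell (w0 n) _ jn tj).
    move: tj; rewrite /cell/= in_itv/= -[j.+1%:R]natr1 mulrDl mul1r => /andP[h1 h2].
    by rewrite ger0_norm; lra.
  by rewrite wE; case=> ?; lra.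
have vout t n : ~ (- M <= t < M) -> v n t = 0.
  move=> tM; rewrite /v comb_out// => j jn; rewrite /cell/= in_itv/= => /andP[h1 h2].
  apply: tM; apply/andP; split.
    by apply: le_trans h1; rewrite lerDl mulr_ge0// ltW.
  apply: lt_le_trans h2 _.
  have : j.+1%:R * w n <= n.+1%:R * w n by rewrite ler_pM2r// ler_nat.
  rewrite wE; lra.
have [] := @dominated_dsq (fun t => g t * \1_(`[- M, M[) t) v
   (fun t => (2 * B) ^+ 2 * \1_(`[- M, M[) t) eps mg _ _ _ _ eps0.
- by move=> n; exact: measurable_comb.
- exact: indic_scale_integrable.
- move=> n t; have [tM|tM] := boolP (- M <= t < M); last first.
    have tM' := negP tM; by rewrite !indic_co_out// vout// !mulr0 subrr expr0n.
  rewrite !indic_co_in// !mulr1; have [s -> _] := vP t n tM.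
  apply: sqr_le_norm; apply: le_trans (ler_normB _ _) _.
  have := gB t; have := gB s; lra.
- move=> t; have [tM|tM] := boolP (- M <= t < M); last first.
    have tM' := negP tM; rewrite indic_co_out// mulr0.
    by rewrite (_ : v^~ t = cst 0); [exact: cvg_cst|apply/funext => n; exact: vout].
  rewrite indic_co_in// mulr1.
  apply/cvgrPdist_lt => e e0.
  have /cvgrPdist_lt/(_ e e0)/nbhs_ballP[d /= d0 gd] := cg t.
  exists (Num.truncn (2 * M / d)).+1 => // n /= nn.
  have [s -> ts] := vP t n tM; apply: gd; rewrite /ball/=.
  apply: le_lt_trans ts _; rewrite /w ltr_pdivrMr// [d * _]mulrC -ltr_pdivrMr//.
  apply: lt_le_trans (truncnS_gt _) _; rewrite ler_nat.
  exact: leqW.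
- move=> n hn; exists (v n); split => //; first exact: measurable_comb.
  exact: ind_comb.
Qed.

(** Turns L^1 approximation into L^2 approximation for uniformly bounded differences. *)
Lemma dsq_le_L1 u v (K : R) (E : set R) : measurable E -> 0 <= K ->
  measurable_fun setT u -> measurable_fun setT v ->
  (forall t, ~ E t -> u t = v t) -> (forall t, E t -> `|u t - v t| <= K) ->
  (dsq u v <= K%:E * \int[mu]_(t in E) `|(u t - v t)%:E|)%E.
Proof.
move=> mE K0 mu_ mv out ins.
have md : measurable_fun setT (fun t => `|(u t - v t)%:E|)%E.
  apply: measurableT_comp => //; apply/measurable_EFinP; exact: measurable_funB.
rewrite [X in (_ * X)%E]integral_mkcond.
have mr : measurable_fun setT ((fun t => `|(u t - v t)%:E|)%E \_ E).
  by apply/(measurable_restrictT _ _).1 => //; exact: measurable_funTS.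
rewrite -ge0_integralZl_EFin//; last first.
  by move=> t _; apply: erestrict_ge0.
apply: ge0_le_integral => //.
- by move=> t _; rewrite lee_fin sqr_ge0.
- by apply/measurable_EFinP; apply: measurable_funX; exact: measurable_funB.
- by apply: emeasurable_funM => //; exact: measurable_cst.
- move=> t _; rewrite /patch; have [Et|Et] := pselect (E t).
    rewrite mem_set//= lee_fin -[leLHS]real_normK ?num_real// expr2.
    by rewrite ler_wpM2r//; exact: ins.
  by rewrite memNset// out// subrr expr0n/= mule0.
Qed.

(** Continuous functions approximate [u] in L^1 on [[- M, M[]. Clipping them to [[- M, M]] brings
    them no farther from [u] and bounds the difference by [2 * M], so the approximation also holds
    in L^2. *)
Lemma ind_bounded u (M : R) : measurable_fun setT u -> (forall t, `|u t| <= M) ->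
  0 < M -> (forall t, ~ (- M <= t < M) -> u t = 0) -> P u.
Proof.
move=> mu_ uM M0 uout.
set E := (`[- M, M[)%classic : set R.
have mE : measurable E by exact: measurable_itv.
have muE : (mu E < +oo)%E by rewrite /E lebesgue_measure_itv/=; case: ifP => _; rewrite -?EFinB ltry.
have iu : mu.-integrable E (EFin \o u).
  apply: (@le_integrable _ _ _ mu E mE _ (cst M%:E)).
  - by apply/measurable_EFinP; exact: measurable_funTS.
  - by move=> t _ /=; rewrite lee_fin (ger0_norm (ltW M0)).
  - apply/integrableP; split; first exact: measurable_cst.
    by rewrite integral_cst//; apply: lte_mul_pinfty.
have [g [cg ig gu]] := approximation_continuous_integrable mE muE iu.
apply: Plim => // eps eps0.
have e2 : 0 < eps / (2 * M) by rewrite divr_gt0// mulr_gt0.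
have [n hn] := cvge0_small gu e2.
pose h : R -> R := (cst (- M)) \max (cst M \min g n).
have ch : continuous h.
  move=> t; apply: (@continuous_max _ _ (cst (- M)) (cst M \min g n)).
    exact: cvg_cst.
  by apply: (@continuous_min _ _ (cst M) (g n)); [exact: cvg_cst|exact: cg].
have hM t : `|h t| <= M.
  rewrite ler_norml /h le_max lexx/= ge_max ge_min lexx/=.
  by apply/andP; split => //; lra.
exists (fun t => h t * \1_(`[- M, M[) t); split.
- by apply: measurable_funM; [exact: continuous_measurable_fun|exact: measurable_indic].
- exact: (ind_continuous ch hM M0).
have mhi : measurable_fun setT (fun t => h t * \1_(`[- M, M[) t).
  by apply: measurable_funM; [exact: continuous_measurable_fun|exact: measurable_indic].
apply: (le_trans (@dsq_le_L1 u _ (2 * M) E mE _ mu_ mhi _ _)).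
- by rewrite mulr_ge0// ltW.
- move=> t; rewrite /E/= in_itv/= => tE.
  by rewrite uout// indic_co_out// mulr0.
- move=> t; rewrite /E/= in_itv/= => tE; rewrite indic_co_in// mulr1.
  apply: le_trans (ler_normB _ _) _; have := uM t; have := hM t; lra.
apply: (@le_trans _ _ ((2 * M)%:E * (eps / (2 * M))%:E)%E); last first.
  by rewrite -EFinM lee_fin mulrCA divff ?mulr1// gt_eqF// mulr_gt0.
apply: lee_wpmul2l; first by rewrite lee_fin mulr_ge0// ltW.
apply: le_trans hn; apply: ge0_le_integral => //.
- apply: measurableT_comp => //; apply/measurable_EFinP; apply: measurable_funTS.
  exact: measurable_funB.
- apply: measurableT_comp => //; apply/measurable_EFinP; apply: measurable_funTS.
  by apply: measurable_funB => //; apply: continuous_measurable_fun; exact: cg.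
- move=> t; rewrite /E/= in_itv/= => tE; rewrite indic_co_in// mulr1 lee_fin.
  exact: clip_dist.
Qed.

(** Truncation of both the values and the support reduces to the bounded case, with [u ^+ 2] as
    dominating function. *)
Lemma L2_dense_ind u : measurable_fun setT u ->
  (\int[mu]_t ((u t) ^+ 2)%:E < +oo)%E -> P u.
Proof.
move=> mu_ u2; apply: Plim => // eps eps0.
pose K n : R := n.+1%:R.
pose good n t := (`|u t| <= K n) && (- K n <= t < K n).
pose v n t := if good n t then u t else 0.
have mv n : measurable_fun setT (v n).
  apply: measurable_fun_ifT => //; apply: measurable_and.
    apply: measurable_fun_ler; last exact: measurable_cst.
    by apply: measurableT_comp.
  apply: measurable_and.
    by apply: measurable_fun_ler => //; exact: measurable_cst.
  by apply: measurable_fun_ltr => //; exact: measurable_cst.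
have iu : mu.-integrable setT (EFin \o (fun t => u t ^+ 2)).
  apply/integrableP; split; first by apply/measurable_EFinP; exact: measurable_funX.
  by under eq_integral do rewrite gee0_abs ?lee_fin ?sqr_ge0//.
have [] := @dominated_dsq u v (fun t => u t ^+ 2) eps mu_ mv iu _ _ eps0.
- move=> n t; rewrite /v; case: ifP => _; last by rewrite subr0.
  by rewrite subrr expr0n sqr_ge0.
- move=> t; apply: cvg_near_cst; exists (Num.truncn (`|u t| + `|t|)).+1 => // n /= nn.
  rewrite /v (_ : good n t)//.
  have : `|u t| + `|t| < K n.
    by apply: lt_le_trans (truncnS_gt _) _; rewrite ler_nat; exact: leqW.
  have := normr_ge0 (u t); have := normr_ge0 t; have := ler_norm t.
  have := ler_norm (- t); rewrite normrN => *.
  by rewrite /good; apply/and3P; split; lra.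
move=> n hn; exists (v n); split => //.
apply: (@ind_bounded _ (K n)) => //.
- by move=> t; rewrite /v /good; case: ifP => [/andP[]//|_]; rewrite normr0.
- by move=> t tK; rewrite /v /good; case: ifP => // /andP[_ /tK].
Qed.

End Induction.
End Density.

(** * Every L^2 function has the homogeneous approximation property *)

Section Approximation.
Variable R : realType.
Local Notation mu := (@lebesgue_measure R).
Local Notation cfun := (cfun R).

Implicit Types (u v : R -> R) (psi : R).

(** A real function in a fixed complex direction. The angles [0] and [pi / 2] give the real and
    imaginary parts, so that density is needed only for real functions. *)
Definition ray (psi : R) (u : R -> R) : cfun := fun t => (cos psi * u t, sin psi * u t).

Lemma meas2_ray psi u : measurable_fun setT u -> meas2 (ray psi u).
Proof. by move=> mu_; split; apply: measurable_funM => //; exact: measurable_cst. Qed.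

Lemma normsq_ray psi u v : normsq (csub (ray psi u) (ray psi v)) = dsq u v.
Proof.
apply: eq_integral => t _; congr (_%:E); rewrite /csub /ray/=.
transitivity ((cos psi ^+ 2 + sin psi ^+ 2) * (u t - v t) ^+ 2); first by ring.
by rewrite cos2Dsin2 mul1r.
Qed.

(** Cells are closed on the left and atoms on the right; the two indicators differ at most at the
    two endpoints. *)
Lemma dsq_indic_itv (p q : R) : (dsq \1_(`[p, q[) \1_(`]p, q]) = 0)%E.
Proof.
have mpt (x : R) : measurable_fun [set: R] (fun t => (\1_[set x] t : R)%:E).
  by apply/measurable_EFinP; apply: measurable_indic; exact: measurable_set1.
have i0 (x : R) : (\int[mu]_t (\1_[set x] t : R)%:E = 0)%E.
  by rewrite integral_indic// setIT; exact: lebesgue_measure_set1.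
apply/eqP; rewrite eq_le; apply/andP; split; last first.
  by apply: integral_ge0 => t _; rewrite lee_fin sqr_ge0.
apply: (@le_trans _ _ (\int[mu]_t ((\1_[set p] t : R)%:E + (\1_[set q] t : R)%:E))%E).
  apply: ge0_le_integral => //.
  - by move=> t _; rewrite lee_fin sqr_ge0.
  - by apply/measurable_EFinP; apply: measurable_funX; apply: measurable_funB => //;
      apply: measurable_indic; exact: measurable_itv.
  - by apply: emeasurable_funD; exact: mpt.
  - move=> t _; rewrite -EFinD lee_fin.
    have pE (a x : R) : \1_[set a] x = (x == a)%:R :> R.
      by rewrite indicE; congr (nat_of_bool _)%:R; apply/idP/eqP; rewrite inE.
    rewrite indic_ocE indic_coE !pE; have [->|tp] := eqVneq t p.
      by rewrite ltxx; case: (_ && _); case: (_ == _);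
        rewrite /= ?subr0 ?expr1n ?expr0n/=; lra.
    have [->|tq] := eqVneq t q.
      by rewrite ltxx andbF sub0r sqrrN; case: (_ && _);
        rewrite /= ?expr1n ?expr0n/=; lra.
    by rewrite !lt_neqAle tq eq_sym tp/= subrr expr0n/=; lra.
rewrite ge0_integralD//; [|exact: mpt..].
by rewrite !i0 adde0.
Qed.

Lemma HAP_ray psi u : measurable_fun setT u ->
  (\int[mu]_t ((u t) ^+ 2)%:E < +oo)%E -> HAP (ray psi u).
Proof.
move=> mu_ u2; apply: (@L2_dense_ind _ (fun u => HAP (ray psi u))) => //.
- move=> v w mv mw Hv Hw.
  have -> : ray psi (v \+ w) = cadf (ray psi v) (ray psi w).
    by apply/funext => t; rewrite /ray /cadf/= !mulrDr.
  by apply: HAP_add => //; exact: meas2_ray.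
- move=> a v mv Hv.
  have -> : ray psi (fun t => a * v t) = cscale a (ray psi v).
    by apply/funext => t; rewrite /ray /cscale/=; congr pair; ring.
  by apply: HAP_scale => //; exact: meas2_ray.
- move=> p q pq; apply: HAP_lim; first by apply: meas2_ray; exact: measurable_indic.
  move=> eps eps0; exists (atom p q psi); split; first exact: meas2_atom.
    exact: HAP_atom.
  by rewrite (normsq_ray psi \1_(`[p, q[) \1_(`]p, q])) dsq_indic_itv lee_fin ltW.
- move=> v mv lim; apply: HAP_lim; first exact: meas2_ray.
  move=> eps /lim[w [mw Hw vw]]; exists (ray psi w); split => //; first exact: meas2_ray.
  by rewrite normsq_ray.
Qed.

Lemma L2_HAP (h : cfun) : L2 h -> HAP h.
Proof.
move=> h2; have [m1 [m2 fin]] := h2.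
have sq (k : R -> R) : measurable_fun setT k -> (forall t, k t ^+ 2 <= sqn h t) ->
    (\int[mu]_t ((k t) ^+ 2)%:E < +oo)%E.
  move=> mk kh; apply: le_lt_trans fin; apply: ge0_le_integral => //.
  - by move=> t _; rewrite lee_fin sqr_ge0.
  - by apply/measurable_EFinP; exact: measurable_funX.
  - exact: meas2_sqn.
  - by move=> t _; rewrite lee_fin; exact: kh.
have -> : h = cadf (ray 0 (fun t => (h t).1)) (ray (pi / 2) (fun t => (h t).2)).
  apply/funext => t; rewrite /cadf /ray/= cos0 sin0 cos_pihalf sin_pihalf.
  by rewrite !mul1r !mul0r addr0 add0r -surjective_pairing.
apply: HAP_add; [exact: meas2_ray..| |]; apply: HAP_ray => //; apply: sq => // t.
  by rewrite lerDl sqr_ge0.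
by rewrite lerDr sqr_ge0.
Qed.

End Approximation.

(** * From complex to real separation *)

Section Separation.
Variable R : realType.
Local Notation cfun := (cfun R).

Lemma sum_pair_bool (V : nmodType) (I : finType) (F : I * bool -> V) :
  \sum_p F p = \sum_i (F (i, true) + F (i, false)).
Proof.
rewrite (eq_bigr (fun p => F (p.1, p.2))); last by case.
rewrite -(pair_bigA _ (fun i c => F (i, c))).
by apply: eq_bigr => i _; rewrite big_bool.
Qed.

(* The doubled family [f], [i f] makes real spans complex; dividing by the
   coefficient of the selected vector, of modulus at least [1], reduces its
   separation to the complex one. *)
Definition cunit (c : bool) : cplx R := if c then (0, 1) else (1, 0).

Lemma lincombE (I : Type) (e : I -> cfun) (s : seq (cplx R * I)) t :
  lincomb e s t = (\sum_(p <- s) (cmul p.1 (e p.2 t)).1, \sum_(p <- s) (cmul p.1 (e p.2 t)).2).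
Proof.
rewrite /lincomb; elim: s => [|p s ih]; first by rewrite !big_nil.
by rewrite !big_cons /= ih.
Qed.

Lemma dist_span_lc (I : eqType) (D : set I) (e : I -> cfun) (d : R) (s : seq I)
    (i0 : 'I_(size s)) (x : 'I_(size s) * bool -> R) (c0 : bool) x0 :
  (forall i, D i -> meas2 (e i)) -> uniq s -> (forall i, i \in s -> D i) ->
  (d%:E < dist_span_sq D e (nth x0 s i0))%E -> x (i0, c0) = 1 ->
  (d%:E <= normsq (lc x (fun ic t => cmul (cunit ic.2) (e (nth x0 s ic.1) t))))%E.
Proof.
move=> me us sD dd x1; set f := fun ic : _ => _.
pose E i := e (nth x0 s i).
have mE (i : 'I_(size s)) : meas2 (E i) by apply: me; apply: sD; exact: mem_nth.
pose z (i : 'I_(size s)) : cplx R := (x (i, false), x (i, true)).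
pose n0 := (z i0).1 ^+ 2 + (z i0).2 ^+ 2.
have n1 : 1 <= n0.
  by rewrite /n0 /z/=; case: c0 x1 => ->; rewrite expr1n ?lerDl ?lerDr sqr_ge0.
have n00 : n0 != 0 by rewrite gt_eqF// (lt_le_trans ltr01).
(* The complex quotient [- z i / z i0], written with the conjugate of [z i0] over its squared
   modulus [n0]. *)
pose y (i : 'I_(size s)) : cplx R :=
  (- ((z i).1 * (z i0).1 + (z i).2 * (z i0).2) / n0,
   - ((z i).2 * (z i0).1 - (z i).1 * (z i0).2) / n0).
pose L := [seq (y i, nth x0 s i) | i <- enum 'I_(size s) & i != i0].
have lcE t : lc x f t =
    (\sum_i (cmul (z i) (E i t)).1, \sum_i (cmul (z i) (E i t)).2).
  by rewrite /lc !sum_pair_bool; congr pair; apply: eq_bigr => i _;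
    rewrite /f /z /cunit /cmul /E/=; ring.
have key t : lc x f t = cmul (z i0) (csub (E i0) (lincomb e L) t).
  rewrite lcE /csub lincombE /L !big_map !big_filter.
  rewrite !big_enum_cond/= (bigD1 i0)//= [X in (_, X)](bigD1 i0)//=.
  set v := E i0 t.
  set A := \sum_(i | _) (cmul (z i) (E i t)).1; set B := \sum_(i | _) (cmul (z i) (E i t)).2.
  set a := \sum_(i | _) _; set b := \sum_(i | _) _.
  have hA : A = - ((z i0).1 * a - (z i0).2 * b).
    rewrite /A /a /b !mulr_sumr -sumrB -sumrN; apply: eq_bigr => i _.
    move: n00; rewrite -/(E i) /cmul /y /n0 /z/= => n00.
    by field.
  have hB : B = - ((z i0).1 * b + (z i0).2 * a).
    rewrite /B /a /b !mulr_sumr -big_split -sumrN; apply: eq_bigr => i _.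
    move: n00; rewrite -/(E i) /cmul /y /n0 /z/= => n00.
    by field.
  by rewrite hA hB /cmul /z/=; congr pair; ring.
have mL : meas2 (lincomb e L).
  have -> : lincomb e L = fun t => (\sum_(p <- L) (cmul p.1 (e p.2 t)).1,
      \sum_(p <- L) (cmul p.1 (e p.2 t)).2).
    by apply/funext => t; exact: lincombE.
  rewrite /L; split => /=; under eq_fun do rewrite big_map;
    apply: measurable_sum => i; have [h1 h2] := mE i;
    [apply: measurable_funB|apply: measurable_funD]; apply: measurable_funM => //;
    exact: measurable_cst.
have mlc : meas2 (lc x f).
  apply: meas2_lc => -[i c]; apply: meas2_mul; last exact: mE.
  by split; exact: measurable_cst.
apply: (@le_trans _ _ (normsq (csub (E i0) (lincomb e L)))).
  apply/ltW/(lt_le_trans dd); apply: ereal_inf_lbound; exists L => //= p /mapP[i].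
  rewrite mem_filter => /andP[ii0 _] ->; split; first by apply: sD; exact: mem_nth.
  by move/eqP; rewrite nth_uniq// => /eqP/val_inj/eqP; rewrite (negPf ii0).
apply: le_normsq => //; first exact: meas2_sub.
move=> t; have := key t; set v := csub _ _ t => kt.
rewrite [leRHS](_ : _ = n0 * sqn (fun=> v) t).
  by rewrite -/v ler_peMl// sqn_ge0.
by rewrite /sqn kt /cmul /n0/=; ring.
Qed.

End Separation.

(** * Counting points in a square and the density bound *)

Section Counting.
Variables (R : realType) (N : nat) (g : 'I_N -> cfun R) (Lam : 'I_N -> set (R * R)).
Local Notation idx := ('I_N * (R * R))%type.
Local Notation D := [set np : idx | Lam np.1 np.2].
Local Notation e := (fun np : idx => gabor (g np.1) np.2).

Lemma L2_mul_cst (c : cplx R) (h : cfun R) : L2 h -> L2 (fun t => cmul c (h t)).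
Proof.
move=> h2; have mh := L2_meas2 h2; have [_ [_ fin]] := h2.
have mc : meas2 (fun t => cmul c (h t)).
  by apply: meas2_mul => //; split; exact: measurable_cst.
apply: L2P => //.
have : (normsq (cscale (Num.sqrt (c.1 ^+ 2 + c.2 ^+ 2)) h) < +oo)%E.
  by have [_ []] := L2_scale (Num.sqrt (c.1 ^+ 2 + c.2 ^+ 2)) h2.
apply: le_lt_trans; apply: le_normsq => //; first exact: meas2_scale.
move=> t; rewrite /sqn /cmul /cscale/= !exprMn sqr_sqrtr ?addr_ge0 ?sqr_ge0//.
by rewrite le_eqVlt; apply/orP; left; apply/eqP; ring.
Qed.

Lemma gabor_mul_cst (c : cplx R) (h : cfun R) z :
  gabor (fun t => cmul c (h t)) z = (fun t => cmul c (gabor h z t)).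
Proof. by apply/funext => t; rewrite /gabor /cmul/=; congr pair; ring. Qed.

Lemma L2_gabor (h : cfun R) z : L2 h -> L2 (gabor h z).
Proof.
move=> h2; have mh := L2_meas2 h2; apply: L2P; first exact: meas2_gabor.
by rewrite normsq_gabor//; case: h2 => _ [].
Qed.

Lemma fin_max_real (I : finType) (Q : I -> R -> Prop) :
  (forall i, exists x, forall y, x <= y -> Q i y) ->
  exists x, forall y, x <= y -> forall i, Q i y.
Proof.
move=> /choice[x hx]; exists (\sum_i `|x i|) => y xy i; apply: hx.
apply: le_trans xy; apply: le_trans (ler_norm _) _.
by rewrite (bigD1 i)//= lerDl sumr_ge0.
Qed.

Lemma fin_max_nat (I : finType) (Q : I -> nat -> Prop) :
  (forall i, exists x, forall y, (x <= y)%N -> Q i y) ->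
  exists x, forall y, (x <= y)%N -> forall i, Q i y.
Proof.
move=> /choice[x hx]; exists (\max_i x i)%N => y xy i; apply: hx.
by apply: leq_trans xy; exact: leq_bigmax.
Qed.

(** There are finitely many generators, each taken with the factors [1] and [i], so one margin
    [rho0] serves for all of them, whatever the square. *)
Lemma count_bound (d kappa : R) : (forall n, L2 (g n)) -> 0 < d -> 0 < kappa ->
  (forall i, D i -> ((d ^+ 2)%:E < dist_span_sq D e i)%E) ->
  exists rho0, forall rho, rho0 <= rho -> forall r ab (s : seq idx), 0 < r ->
  uniq s -> (forall i, i \in s -> D i /\ Qsq ab r i.2) ->
  (size s)%:R * (1 - kappa) <= (window r rho)%:R.
Proof.
move=> g2 d0 k0 sep.
have eps0 : 0 < kappa ^+ 2 * d ^+ 2 by rewrite mulr_gt0// exprn_gt0.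
pose gc (nc : 'I_N * bool) : cfun R := fun t => cmul (cunit R nc.2) (g nc.1 t).
have gc2 nc : L2 (gc nc) by exact: L2_mul_cst.
have [rho0 hrho] := fin_max_real (fun nc => L2_HAP (gc2 nc) eps0).
exists (Num.max 1 rho0) => rho; rewrite ge_max => /andP[rho1 rhor] r [a0 b0] s r0 us sD.
case: s us sD => [|x0 s'] us sD; first by rewrite mul0r ler0n.
set s := x0 :: s' in us sD *.
pose f (ic : 'I_(size s) * bool) : cfun R :=
  fun t => cmul (cunit R ic.2) (e (nth x0 s ic.1) t).
have fE i c : f (i, c) = gabor (gc ((nth x0 s i).1, c)) (nth x0 s i).2.
  by rewrite gabor_mul_cst.
have [M hM] : exists M, forall Q, (M <= Q)%N -> forall ic, exists c,
    (normsq (csub (f ic) (lc c (window_basis r rho a0 b0 Q))) <=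
     (kappa ^+ 2 * d ^+ 2)%:E)%E.
  apply: fin_max_nat => -[i c]; rewrite fE.
  have [_ [za zb]] := sD _ (mem_nth x0 (ltn_ord i)).
  rewrite [X in gabor _ X]surjective_pairing.
  exact: (hrho _ rhor _ _ _ _ _ _ (ltW r0) za zb).
(* Fine enough for every approximation, and with at least as many cells as window frequencies, as
   orthonormality requires. *)
pose Q := (M + window r rho)%N.
have Q0 : (0 < Q)%N by rewrite /Q addnS.
have T0 : 0 < 2 * (r + rho) by lra.
have := @separated_card_le R ('I_(size s) * bool)%type ('I_(window r rho) * bool)%type
  f (window_basis r rho a0 b0 Q) (d ^+ 2) kappa (exprn_gt0 _ d0) k0.
rewrite !card_prod !card_ord card_bool !natrM => h.
(* Both families are indexed by a product with [bool]; multiplying by 2 restores their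
   cardinalities. *)
rewrite -(ler_pM2r (_ : 0 < 2%:R))//; rewrite mulrAC; apply: h.
- by case=> i c; rewrite fE; exact: L2_gabor.
- by move=> kp; exact: L2_basis.
- move=> [k c] [l c']; rewrite basis_ortho//= ?xpair_eqE//.
    by apply: leq_trans (ltn_ord k) _; rewrite leq_addl.
  by apply: leq_trans (ltn_ord l) _; rewrite leq_addl.
- move=> x [i0 c0] x1; apply: (@dist_span_lc _ _ D e _ s i0 x c0 x0) => //.
  + by move=> i _; apply: L2_meas2; exact: L2_gabor.
  + by move=> i /sD[].
  + by apply: sep; case: (sD _ (mem_nth x0 (ltn_ord i0))).
- by apply: hM; rewrite leq_addr.
Qed.

(** The sum of cardinalities is a sum over pairs [(n, x)], that is a supremum over finite sets of
    pairs; a bound on duplicate-free lists therefore also excludes infinite sets. *)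
Lemma ecard_sum_le (A : 'I_N -> set (R * R)) (C : R) :
  (forall s : seq idx, uniq s -> (forall i, i \in s -> A i.1 i.2) -> (size s)%:R <= C) ->
  (\sum_(n < N) ecard (A n) <= C%:E)%E.
Proof.
move=> AC.
have setTE : [set: 'I_N] = [set` index_enum 'I_N].
  by apply/seteqP; split=> n _ //=; rewrite mem_index_enum.
have -> : (\sum_(n < N) ecard (A n) = \esum_(n in [set: 'I_N]) \esum_(x in A n) 1)%E.
  rewrite esum_fset//=; last by move=> n _; exact: esum_ge0.
  by rewrite setTE -fsbig_seq// index_enum_uniq.
rewrite esum_esum//; apply: ge_ereal_sup => _ [F [finF FA] <-].
rewrite fsbig_finite//= sumEFin lee_fin.
rewrite big_const_seq count_predT iter_addr_0.
apply: AC => [|i]; first exact: finmap.fset_uniq.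
by rewrite in_fset_set// inE => /FA[].
Qed.

Lemma window_le (r rho : R) : (window r rho)%:R <= (2 * (r + rho)) ^+ 2 + 1.
Proof.
by rewrite /window -[_.+1%:R]natr1 lerD2r truncn_le// sqr_ge0.
Qed.

(* [8 * r * rho + 4 * rho ^+ 2 + 1 <= 13 * r * rho] *)
Lemma density_ratio (eta rho r : R) : 0 < eta -> 1 <= rho -> rho < r ->
  13 * rho / (2 * eta) < r ->
  (window r rho)%:R / (1 - eta / (2 * (1 + eta))) * ((2 * r) ^+ 2)^-1 <= 1 + eta.
Proof.
move=> eta0 rho1 rhor hr; have r0 : 0 < r by lra.
have k1 : 1 - eta / (2 * (1 + eta)) = (2 + eta) / (2 * (1 + eta)).
  by field; rewrite gt_eqF//; lra.
have k0 : 0 < 1 - eta / (2 * (1 + eta)) by rewrite k1 divr_gt0//; lra.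
rewrite ler_pdivrMr ?exprn_gt0 ?mulr_gt0// ler_pdivrMr//.
have -> : (1 + eta) * (2 * r) ^+ 2 * (1 - eta / (2 * (1 + eta))) =
    (1 + eta / 2) * (2 * r) ^+ 2.
  by field; rewrite gt_eqF//; lra.
apply: le_trans (window_le _ _) _.
have : 13 * rho * r <= 2 * eta * r * r.
  by rewrite ler_pM2r//; move: hr; rewrite ltr_pdivrMr ?mulr_gt0//; lra.
have : rho * rho <= rho * r by rewrite ler_pM2l; lra.
have : 1 <= rho * r by rewrite -[leLHS]mulr1; apply: ler_pM; lra.
rewrite !expr2; lra.
Qed.

End Counting.

Theorem theorem2 (R : realType) (N : nat) (g : 'I_N -> cfun R)
    (Lam : 'I_N -> set (R * R)) :
  (forall n, L2 (g n)) ->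
  uniformly_minimal [set np : 'I_N * (R * R) | Lam np.1 np.2]
                    (fun np => gabor (g np.1) np.2) ->
  (upper_density Lam <= 1)%E.
Proof.
move=> g2 [d [d0 sep]]; apply/lee_addgt0Pr => eta eta0.
(* This is [kappa], chosen so that [(1 + eta) * (1 - kappa) = 1 + eta / 2]: half of [eta] pays for
   the trace loss, half for the boundary layer. *)
have k0 : 0 < eta / (2 * (1 + eta)) by rewrite divr_gt0//; lra.
have [rho0 hrho] := count_bound g2 d0 k0 sep.
pose rho := Num.max 1 rho0.
have rho1 : 1 <= rho by rewrite le_max lexx.
have {hrho} hrho := hrho rho _.
(* The second bound gives [13 * rho * r <= 2 * eta * r ^+ 2], the slack left by
   [(1 + eta / 2) * (2 * r) ^+ 2]. As the limit superior is an infimum over neighborhoods of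
   infinity, this single one suffices. *)
pose V := [set r : R | Num.max rho (13 * rho / (2 * eta)) < r].
rewrite /upper_density limf_esupE; apply: ge_ereal_inf.
eexists.
  exists V; last by [].
  by exists (Num.max rho (13 * rho / (2 * eta))); split => //; exact: num_real.
apply: ge_ereal_sup => _ [r + <-]; rewrite /V/= gt_max => /andP[rhor etar].
have r0 : 0 < r by lra.
have kk : 0 < 1 - eta / (2 * (1 + eta)).
  have -> : 1 - eta / (2 * (1 + eta)) = (2 + eta) / (2 * (1 + eta)).
    by field; rewrite gt_eqF//; lra.
  by rewrite divr_gt0//; lra.
apply: (@le_trans _ _ (((window r rho)%:R / (1 - eta / (2 * (1 + eta))))%:E *
    ((2 * r) ^+ 2)^-1%:E)%E); last first.
  by rewrite -EFinM -EFinD lee_fin; exact: density_ratio.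
apply: lee_wpmul2r; first by rewrite lee_fin invr_ge0 sqr_ge0.
apply: ge_ereal_sup => _ [ab _ <-]; apply: ecard_sum_le => s us sA.
rewrite ler_pdivlMr//; apply: (hrho _ r ab) => //.
  by rewrite le_max lexx orbT.
Qed.
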